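(* Let $E\subset\mathbb{R}^3$ be a finite set of $n$ points (with $n$ large), and let $\Lambda_k(E)$ denote $\Lambda_k(E;\pi/2,\dots,\pi/2)$ (right angle $k$-chains). Then $$|\Lambda_1(E)|\lesssim n^{7/3},\quad |\Lambda_2(E)|\lesssim n^{10/3},\quad |\Lambda_3(E)|\lesssim n^4,\quad |\Lambda_4(E)|\lesssim n^{13/3},\quad |\Lambda_5(E)|\lesssim n^5,$$ and for every $k\ge 6$, $$|\Lambda_k(E)|\lesssim n^{\frac{1}{3}\left(19+\left\lfloor\frac{7(k-7)}{4}\right\rfloor\right)}.$$
   Context: For points $x,y,z$ with $x\ne y\ne z$, $\angle(x,y,z)\in[0,\pi]$ is the angle at $y$ between $x-y$ and $z-y$. $\Lambda_k(E;\alpha_1,\dots,\alpha_k)$ is the set of tuples $(x_1,\dots,x_{k+2})\in E^{k+2}$ with $\angle(x_j,x_{j+1},x_{j+2})=\alpha_j$ for all $1\le j\le k$. $X(n)\lesssim Y(n)$ means $X(n)\le CY(n)$ for $n>N$ with constants $C,N$ independent of $n$ (possibly depending on $k$). *)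

(* Defs.v *)
From mathcomp Require Import all_boot all_order all_algebra finmap.
From mathcomp Require Import all_classical reals exp trigo.
Set Implicit Arguments.
Unset Strict Implicit.
Unset Printing Implicit Defensive.
Import Order.TTheory GRing.Theory Num.Theory.
Local Open Scope ring_scope.

(* The library norm on row vectors is the sup norm, hence the explicit
   Euclidean structure. *)
Definition dot (R : realType) (d : nat) (u v : 'rV[R]_d) : R :=
  \sum_(i < d) u ord0 i * v ord0 i.

Definition enorm (R : realType) (d : nat) (u : 'rV[R]_d) : R :=
  Num.sqrt (dot u u).

(* Only meaningful when x != y and y != z; degenerate triples get the junk
   value acos 0 = pi / 2, so users must exclude them. *)
Definition angle (R : realType) (d : nat) (x y z : 'rV[R]_d) : R :=
  acos (dot (x - y) (z - y) / (enorm (x - y) * enorm (z - y))).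

Definition has_angle (R : realType) (d : nat) (x y z : 'rV[R]_d) (a : R)
    : bool :=
  [&& x != y, y != z & angle x y z == a].

(* Tuples (x_0, ..., x_{k+1}) of points of E, indexed from 0. *)
Definition Lambda (R : realType) (d : nat) (k : nat) (E : {fset 'rV[R]_d})
    (alpha : 'I_k -> R) : {set {ffun 'I_k.+2 -> E}} :=
  [set x : {ffun 'I_k.+2 -> E} |
     [forall j : 'I_k,
        has_angle (val (x (inord j))) (val (x (inord j.+1)))
                  (val (x (inord j.+2))) (alpha j)]]%SET.

Definition right_Lambda (R : realType) (d : nat) (k : nat)
    (E : {fset 'rV[R]_d}) : {set {ffun 'I_k.+2 -> E}} :=
  Lambda E (fun _ : 'I_k => pi / 2).

(* |Lambda_k(E)| <~ n ^ e for n-point sets E in R^3; the constants C and N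
   may depend on k and e but are uniform in E. *)
Definition right_chains_lesssim (R : realType) (k : nat) (e : R) : Prop :=
  exists (C : R) (N : nat), forall E : {fset 'rV[R]_3},
    (N < #|` E|)%N ->
    #|right_Lambda k E|%:R <= C * #|` E|%:R `^ e.

(* Main.v *)
(* Crossing lemma. In a plane graph without vertical edges, let [e'] be the
   edge next above [e] among those leaving the same left endpoint.  Sweeping
   the wedge between them to the right, the first vertex met determines [e]
   (it is interior to the wedge, or the right endpoint of [e], or that of
   [e']), so there are at most 4 edges per vertex.  Averaging over random
   vertex samples of density 1/q gives the crossing lemma, and its
   application to consecutive points on lines gives Szemeredi-Trotter, with a
   free integer parameter q in place of fractional powers.

   Right angles. The lines through an apex y are points of a projective
   plane, and orthogonality is an incidence relation there.  Group them by
   the number of points they contain, in powers of 8; the number of lines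
   with many points is again bounded by Szemeredi-Trotter.  Very rich lines
   are treated separately: such a line and a point off it determine the apex.

   Chains. Fix a, b and consider right chains a, b, c, d, f, g.  If the planes
   through b and d, orthogonal to ab and df, are not parallel, then c lies on
   a line and on the sphere with diameter bd, so the right angle d, f, g
   leaves two choices for c.  Otherwise c and d form a right angle b, c, d in
   a fixed plane, which allows n^(4/3) choices by Szemeredi-Trotter, and g
   determines f as a projection.  So four more points cost a factor n^(7/3),
   and the cases k <= 3 are direct. *)
From mathcomp Require Import all_boot all_order all_algebra.
From mathcomp Require Import ring lra zify.
Set Implicit Arguments.
Unset Strict Implicit.
Unset Printing Implicit Defensive.
Import Order.TTheory GRing.Theory Num.Theory.
Local Open Scope ring_scope.

(** * Plane graphs *)

(** Choosing witnesses gives an injection from [X] to [Y]. With a relation, a charging scheme need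
    only describe its target, not compute it. *)
Lemma card_le_rel (A B : finType) (X : {set A}) (Y : {set B})
    (P : A -> B -> Prop) :
  {in X, forall a, exists2 b, b \in Y & P a b} ->
  {in X &, forall a1 a2, forall b, P a1 b -> P a2 b -> a1 = a2} ->
  (#|X| <= #|Y|)%N.
Proof.
move=> hex inj.
(* The choice function needs a value outside [X] even if [B] is empty, hence [option B]. *)
have /fin_all_exists [f hf] (a : A) :
    exists b : option B, a \in X -> exists2 b', b = Some b' & b' \in Y /\ P a b'.
  have [aX|_] := boolP (a \in X); last by exists None.
  by have [b bY Pab] := hex _ aX; exists (Some b) => _; exists b.
have fi : {in X &, injective f}.
  move=> a1 a2 X1 X2 fE; have [b1 E1 [_ P1]] := hf _ X1.
  have [b2 E2 [_ P2]] := hf _ X2; apply: (inj _ _ X1 X2 b1) => //.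
  by move: E2; rewrite -fE E1 => -[->].
have sI : injective (@Some B) by move=> ? ? [].
rewrite -(card_in_imset fi) -(card_imset (mem Y) sI).
apply/subset_leq_card/subsetP => _ /imsetP[a aX ->].
by have [b -> [bY _]] := hf _ aX; apply: imset_f.
Qed.

Lemma affine_root (R : realFieldType) (a b x1 x2 : R) :
  x1 < x2 -> a * x1 + b <= 0 -> 0 < a * x2 + b ->
  exists2 x, x1 <= x < x2 & a * x + b = 0.
Proof.
move=> x12 h1 h2.
have a0 : 0 < a by nra.
exists (- b / a); last by field; rewrite gt_eqF.
by rewrite ler_pdivlMr // ltr_pdivrMr //; apply/andP; split; nra.
Qed.

Lemma affine_lt_right (R : realFieldType) (a b c d x t : R) :
  a * x + b = c * x + d -> x < t -> (a * t + b < c * t + d) = (a < c).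
Proof.
move=> E xt; have D : c * t + d - (a * t + b) = (c - a) * (t - x) by lra.
by rewrite -subr_gt0 D pmulr_lgt0 ?subr_gt0.
Qed.

Lemma affine_lt_left (R : realFieldType) (a b c d x t : R) :
  a * x + b = c * x + d -> t < x -> (a * t + b < c * t + d) = (c < a).
Proof.
move=> E xt; have D : c * t + d - (a * t + b) = (a - c) * (x - t) by lra.
by rewrite -subr_gt0 D pmulr_lgt0 ?subr_gt0.
Qed.

Section PlaneGraph.
Variables (R : realFieldType) (V W : finType).
Variables (px py : V -> R) (l r : W -> V) (sl ic : W -> R).
Variables (S : {set V}) (F : {set W}).

(** An edge is a straight segment: the part of the line with slope [sl e] and intercept [ic e]
    between the endpoints [l e] and [r e]. *)
Let ev (e : W) (x : R) := sl e * x + ic e.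

Hypothesis points_inj :
  {in S &, forall u v, px u = px v -> py u = py v -> u = v}.
Hypothesis edge_lr : {in F, forall e, px (l e) < px (r e)}.
Hypothesis edge_lS : {in F, forall e, l e \in S}.
Hypothesis edge_rS : {in F, forall e, r e \in S}.
Hypothesis edge_l : {in F, forall e, py (l e) = ev e (px (l e))}.
Hypothesis edge_r : {in F, forall e, py (r e) = ev e (px (r e))}.
Hypothesis edge_empty : {in F & S, forall e v,
  px (l e) < px v -> px v < px (r e) -> py v != ev e (px v)}.
Hypothesis edge_disjoint : {in F &, forall e f, e != f -> forall x,
  px (l e) < x -> x < px (r e) -> px (l f) < x -> x < px (r f) ->
  ev e x != ev f x}.


(** If the order failed at [x1], the two lines would meet over some [x] with [x1 <= x < x2].
    Disjointness allows this only at a left end of one of the edges, so [x = x1]. *)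
Lemma edge_order_left (e f : W) (x1 x2 : R) : e \in F -> f \in F ->
  x1 < x2 -> px (l e) <= x1 -> px (l f) <= x1 ->
  x2 <= px (r e) -> x2 <= px (r f) -> ev e x2 < ev f x2 ->
  ev e x1 < ev f x1 \/
  ev e x1 = ev f x1 /\ ((px (l e) == x1) || (px (l f) == x1)).
Proof.
move=> eF fF x12 le lf re rf h2; have [|h1] := ltP; [by left|right].
have h1' : (sl f - sl e) * x1 + (ic f - ic e) <= 0 by move: h1; rewrite /ev; lra.
have h2' : 0 < (sl f - sl e) * x2 + (ic f - ic e) by move: h2; rewrite /ev; lra.
have [x /andP[xa xb] xE] := affine_root x12 h1' h2'.
have nef : e != f by apply: contraTneq h2 => ->; rewrite ltxx.
have xE' : ev e x = ev f x by rewrite /ev; lra.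
have [/andP[a1 a2]|] := boolP ((px (l e) < x) && (px (l f) < x)).
  by have /eqP[] := @edge_disjoint e f eF fF nef x a1 ltac:(lra) a2 ltac:(lra).
rewrite negb_and -!leNgt => h.
have xx : x = x1 by case/orP: h => h; lra.
by rewrite -xx in le lf h1 *; split => //; rewrite !eq_le le lf !andTb.
Qed.

Lemma edge_eq (e f : W) (x : R) : e \in F -> f \in F ->
  px (l e) < x -> x < px (r e) -> px (l f) < x -> x < px (r f) ->
  ev e x = ev f x -> e = f.
Proof.
move=> eF fF e1 e2 f1 f2 E; apply/eqP; apply: contra_eqT E => ef.
exact: edge_disjoint.
Qed.

(** Just to the right of the common endpoint the two segments overlap, so disjointness makes them
    equal. *)
Lemma edge_eq_left (e f : W) : e \in F -> f \in F ->
  l e = l f -> sl e = sl f -> e = f.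
Proof.
move=> eF fF lE sE.
have icE : ic e = ic f.
  by have := edge_l eF; rewrite lE edge_l // /ev sE => /addrI.
pose m := Order.min (px (r e)) (px (r f)).
have lm : px (l e) < m by rewrite lt_min edge_lr // lE edge_lr.
have [me mf] : m <= px (r e) /\ m <= px (r f).
  by rewrite /m !ge_min !lexx orbT.
apply: (@edge_eq e f ((px (l e) + m) / 2)); rewrite -?lE //; try lra.
by rewrite /ev sE icE.
Qed.

Lemma edge_eq_right (e f : W) : e \in F -> f \in F ->
  r e = r f -> sl e = sl f -> e = f.
Proof.
move=> eF fF rE sE.
have icE : ic e = ic f.
  by have := edge_r eF; rewrite rE edge_r // /ev sE => /addrI.
pose m := Order.max (px (l e)) (px (l f)).
have lm : m < px (r e) by rewrite gt_max edge_lr // rE edge_lr.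
have [me mf] : px (l e) <= m /\ px (l f) <= m.
  by rewrite /m !le_max !lexx orbT.
apply: (@edge_eq e f ((px (r e) + m) / 2)); rewrite -?rE //; try lra.
by rewrite /ev sE icE.
Qed.

Definition next_edge (e e' : W) : Prop :=
  [/\ e' \in F, l e' = l e, sl e < sl e' &
   forall g, g \in F -> l g = l e -> sl e < sl g -> sl e' <= sl g].

Definition empty_wedge (e e' : W) (X : R) : Prop :=
  forall v, v \in S -> px (l e) < px v -> px v < X ->
  ev e (px v) < py v -> py v < ev e' (px v) -> False.

(* An edge inside the wedge cannot start in the wedge, so it starts at the
   apex, contradicting the choice of [e']. *)
Lemma no_edge_in_wedge (e e' f : W) (X t : R) :
  e \in F -> f \in F -> next_edge e e' -> empty_wedge e e' X ->
  X <= px (r e) -> X <= px (r e') -> X <= px (r f) ->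
  px (l e) < t -> px (l f) < t -> t < X ->
  ev e t < ev f t -> ev f t < ev e' t -> False.
Proof.
move=> eF fF [e'F le'] sl' nxt wed Xe Xe' Xf let_ lft tX ef fe'.
have [lef|lfe] := ltP (px (l e)) (px (l f)).
  have le'f : px (l e') < px (l f) by rewrite le'.
  have H1 : ev e (px (l f)) < py (l f).
    have [|[E _]] := edge_order_left eF fF lft (ltW lef) (lexx _) ltac:(lra) ltac:(lra) ef.
      by rewrite -edge_l.
    have /eqP[] := edge_empty eF (edge_lS fF) lef ltac:(lra).
    by rewrite E edge_l.
  have H2 : py (l f) < ev e' (px (l f)).
    have [|[E _]] := edge_order_left fF e'F lft (lexx _) (ltW le'f) ltac:(lra) ltac:(lra) fe'.
      by rewrite -edge_l.
    have /eqP[] := edge_empty e'F (edge_lS fF) le'f ltac:(lra).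
    by rewrite -E edge_l.
  by apply: (wed (l f)) => //; [exact: edge_lS|lra].
(* Now [f] starts at or left of the apex; squeezed between two edges that meet there, it passes
   through the apex. Starting further left would put a vertex in its interior; starting at the apex
   gives it a slope between those of [e] and [e']. *)
have E1 : ev e (px (l e)) = ev e' (px (l e)) by rewrite -edge_l // -le' edge_l.
have H1 : ev e (px (l e)) <= ev f (px (l e)).
  by have [/ltW|[->]] := edge_order_left eF fF let_ (lexx _) lfe ltac:(lra) ltac:(lra) ef.
have H2 : ev f (px (l e)) <= ev e' (px (l e)).
  have lee' : px (l e') <= px (l e) by rewrite le'.
  by have [/ltW|[->]] := edge_order_left fF e'F let_ lfe lee' ltac:(lra) ltac:(lra) fe'.
have E : ev f (px (l e)) = py (l e) by rewrite edge_l //; lra.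
have [lfe'|lfe'] := ltP (px (l f)) (px (l e)).
  have /eqP[] := edge_empty fF (edge_lS eF) lfe' ltac:(lra).
  by rewrite E.
have pE : px (l f) = px (l e) by lra.
have lE : l f = l e.
  by apply: points_inj; rewrite ?edge_lS // edge_l // pE.
have h1 : sl e < sl f.
  rewrite -(affine_lt_right (b := ic e) (d := ic f) _ let_) //.
  by rewrite -/(ev e _) -/(ev f _) -edge_l.
have h2 : sl f < sl e'.
  rewrite -(affine_lt_right (b := ic f) (d := ic e') _ let_) //.
  by rewrite -/(ev e' _) -/(ev f _) E -E1 -edge_l.
by have := nxt _ fF lE h1; rewrite leNgt h2.
Qed.

(** The tag records how the sweep ends: 0 if [e] is the topmost edge at its left endpoint, so that
    there is no wedge, 1 at a vertex inside the wedge, 2 at the right end of [e], 3 at the right end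
    of [e']. *)
Let charge (e : W) (vi : V * 'I_4) : Prop :=
  let: (v, i) := vi in
  match val i with
  | 0%N => v = l e /\ forall g, g \in F -> l g = l e -> sl g <= sl e
  | 1%N => exists e', [/\ next_edge e e', empty_wedge e e' (px v),
           px (l e) < px v < px (r e), px v < px (r e') &
           ev e (px v) < py v < ev e' (px v)]
  | 2%N => exists e', [/\ next_edge e e', empty_wedge e e' (px v),
           v = r e & px v <= px (r e')]
  | _ => exists e', [/\ next_edge e e', empty_wedge e e' (px v),
           v = r e' & px v <= px (r e)]
  end.

Lemma charge_ex : {in F, forall e,
  exists2 vi, vi \in setX S [set: 'I_4] & charge e vi}.
Proof.
move=> e eF.
pose P g := [&& g \in F, l g == l e & sl e < sl g].
have [/existsP[g0 Pg0]|nP] := boolP [exists g, P g]; last first.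
  exists (l e, @inord 3 0); rewrite ?inE ?edge_lS //= inordK //; split => // g gF gl.
  rewrite leNgt; apply: contra nP => h; apply/existsP; exists g.
  by rewrite /P gF gl eqxx.
have [e' /and3P[e'F /eqP le' sle'] mine'] := arg_minP sl Pg0.
have ne : next_edge e e'.
  by split=> // g gF gl sg; apply: mine'; rewrite /P gF gl eqxx.
(* The wedge extends to the abscissa [m] where its shorter side ends. If it contains vertices, it is
   empty before the leftmost of them. *)
pose m := Order.min (px (r e)) (px (r e')).
pose Q v := [&& v \in S, px (l e) < px v, px v < m, ev e (px v) < py v & py v < ev e' (px v)].
have [/existsP[v0 Qv0]|nQ] := boolP [exists v, Q v].
  have [v /and5P[vS v1 v2 v3 v4] minv] := arg_minP px Qv0.
  move: (v2); rewrite lt_min => /andP[v5 v6].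
  exists (v, @inord 3 1); rewrite ?inE ?vS //= inordK //; exists e'; split => //.
    move=> w wS w1 w2 w3 w4; have : Q w by rewrite /Q wS w1 w3 w4 (lt_trans w2).
    by move/minv; rewrite leNgt w2.
    by rewrite v1.
  by rewrite v3.
have ew X : X <= m -> empty_wedge e e' X.
  move=> Xm v vS v1 v2 v3 v4; move/negP: nQ; apply; apply/existsP; exists v.
  by rewrite /Q vS v1 v3 v4 (lt_le_trans v2).
have [re|re] := leP (px (r e)) (px (r e')).
  exists (r e, @inord 3 2); rewrite ?inE ?edge_rS //= inordK //; exists e'; split => //.
  by apply: ew; rewrite /m le_min lexx.
exists (r e', @inord 3 3); rewrite ?inE ?edge_rS //= inordK //; exists e'; split => //.
  by apply: ew; rewrite /m le_min lexx andbT ltW.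
exact: ltW.
Qed.

Lemma next_edge_inj (e1 e2 e' : W) : e1 \in F -> e2 \in F ->
  next_edge e1 e' -> next_edge e2 e' -> e1 = e2.
Proof.
move=> F1 F2 [F' l1 s1 n1] [_ l2 s2 n2].
have lE : l e1 = l e2 by rewrite -l1 l2.
apply: edge_eq_left => //; have [h|h|//] := ltgtP (sl e1) (sl e2).
  by have := n1 _ F2 (esym lE) h; rewrite leNgt s2.
by have := n2 _ F1 lE h; rewrite leNgt s1.
Qed.

(** The order of [e] and [f] just to the left of [X]: if they meet at [X], the steeper one is the
    lower one there. *)
Definition above_before (e f : W) (X : R) : Prop :=
  ev e X < ev f X \/ ev e X = ev f X /\ sl f < sl e.

Lemma above_before_lt (e f : W) (X t : R) : e \in F -> f \in F ->
  px (l e) < t -> px (l f) < t -> t < X -> X <= px (r e) -> X <= px (r f) ->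
  above_before e f X -> ev e t < ev f t.
Proof.
move=> eF fF le lf tX re rf [h|[E s]].
  have [//|[_ /orP[] /eqP]] := edge_order_left eF fF tX (ltW le) (ltW lf) re rf h.
    by move=> E; rewrite E ltxx in le.
  by move=> E; rewrite E ltxx in lf.
by rewrite (affine_lt_left E).
Qed.

(** All three edges are present between the later of the left ends and [X], so the order near [X]
    can be moved to such an abscissa, where [no_edge_in_wedge] applies. *)
Lemma no_edge_enters_wedge (e e' f : W) (X : R) :
  e \in F -> f \in F -> next_edge e e' -> empty_wedge e e' X ->
  px (l e) < X <= px (r e) -> X <= px (r e') -> px (l f) < X <= px (r f) ->
  above_before e f X -> above_before f e' X -> False.
Proof.
move=> eF fF ne ew /andP[eX Xe] Xe' /andP[fX Xf] ef fe'.
pose m := Order.max (px (l e)) (px (l f)).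
have [me mf] : px (l e) <= m /\ px (l f) <= m.
  by rewrite /m !le_max !lexx orbT.
have mX : m < X by rewrite gt_max eX.
pose t := (m + X) / 2.
have [t1 t2] : m < t /\ t < X by rewrite /t; split; lra.
have [e'F le' _ _] := ne.
have et : px (l e) < t by lra.
have ft : px (l f) < t by lra.
apply: (no_edge_in_wedge eF fF ne ew Xe Xe' Xf et ft t2).
  exact: (@above_before_lt _ _ X).
by apply: (@above_before_lt _ _ X) => //; rewrite le'.
Qed.

Lemma wedge_above (e e' : W) (x : R) : e \in F -> next_edge e e' ->
  px (l e) < x -> ev e x < ev e' x.
Proof.
move=> eF [e'F le' s _] ex; rewrite (affine_lt_right _ ex) //.
by rewrite -/(ev e _) -/(ev e' _) -edge_l // -le' edge_l.
Qed.

(** If two different edges had the same charge at [v], an edge reaching [v], or passing just below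
    it, would enter the empty wedge of the other. For tag 0 the edge is the steepest one at [v]; for
    tag 3 the comparison is between the upper sides, which determine the lower ones. *)
Lemma charge_inj : {in F &, forall e1 e2, forall vi,
  charge e1 vi -> charge e2 vi -> e1 = e2}.
Proof.
move=> e1 e2 F1 F2 [v [[|[|[|i]]] /= _]].
- move=> [l1 n1] [l2 n2]; apply: edge_eq_left => //; first by rewrite -l1.
  by apply/eqP; rewrite eq_le n1 ?n2 // -?l1 // -l2.
- move=> [e1' [n1 w1 /andP[v1 v1'] v1'' /andP[b1 b1']]].
  move=> [e2' [n2 w2 /andP[v2 v2'] v2'' /andP[b2 b2']]].
  have [h|h|] := ltgtP (ev e1 (px v)) (ev e2 (px v)); last exact: edge_eq.
    exfalso; apply: (no_edge_enters_wedge F1 F2 n1 w1); rewrite ?v1 ?v2 ?ltW //.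
      by left.
    by left; lra.
  exfalso; apply: (no_edge_enters_wedge F2 F1 n2 w2); rewrite ?v1 ?v2 ?ltW //.
    by left.
  by left; lra.
- move=> [e1' [n1 w1 v1 v1']] [e2' [n2 w2 v2 v2']].
  have E : ev e1 (px v) = ev e2 (px v) by rewrite {1}v1 v2 -!edge_r // -v1 -v2.
  have x1 : px (l e1) < px v by rewrite v1 edge_lr.
  have x2 : px (l e2) < px v by rewrite v2 edge_lr.
  have [h|h|] := ltgtP (sl e1) (sl e2).
  + exfalso; apply: (no_edge_enters_wedge F2 F1 n2 w2); rewrite ?x1 ?x2 -?v1 -?v2 //=.
      by right.
    by left; rewrite E wedge_above.
  + exfalso; apply: (no_edge_enters_wedge F1 F2 n1 w1); rewrite ?x1 ?x2 -?v1 -?v2 //=.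
      by right.
    by left; rewrite -E wedge_above.
  + by apply: edge_eq_right; rewrite // -v1.
- move=> [e1' [n1 w1 v1 v1']] [e2' [n2 w2 v2 v2']].
  have [F1' l1 _ _] := n1; have [F2' l2 _ _] := n2.
  have E : ev e1' (px v) = ev e2' (px v) by rewrite {1}v1 v2 -!edge_r // -v1 -v2.
  have x1 : px (l e1') < px v by rewrite v1 edge_lr.
  have x2 : px (l e2') < px v by rewrite v2 edge_lr.
  have y1 : px (l e1) < px v by rewrite -l1.
  have y2 : px (l e2) < px v by rewrite -l2.
  have [h|h|h] := ltgtP (sl e1') (sl e2').
  + exfalso; apply: (no_edge_enters_wedge F1 F2' n1 w1); rewrite ?y1 ?x2 -?v1 -?v2 //=.
      by left; rewrite -E wedge_above.
    by right.
  + exfalso; apply: (no_edge_enters_wedge F2 F1' n2 w2); rewrite ?y2 ?x1 -?v1 -?v2 //=.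
      by left; rewrite E wedge_above.
    by right.
  + apply: (@next_edge_inj e1 e2 e1') => //.
    by have -> : e1' = e2' by apply: edge_eq_right; rewrite // -v1.
Qed.

Lemma card_plane_graph : (#|F| <= 4 * #|S|)%N.
Proof.
have -> : (4 * #|S| = #|setX S [set: 'I_4]|)%N.
  by rewrite cardsX cardsT card_ord mulnC.
exact: (card_le_rel charge_ex charge_inj).
Qed.

End PlaneGraph.

(** * The crossing lemma *)

(** The zero set of a random function is a random sample of density [1/(q+1)]; it contains [T] for a
    proportion [(q+1)^(-|T|)] of all functions. *)
Lemma card_ffun_eq0 (I : finType) (q : nat) (T : {set I}) :
  (#|[set f : {ffun I -> 'I_q.+1} | [forall i in T, f i == ord0]]| * q.+1 ^ #|T|
   = q.+1 ^ #|I|)%N.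
Proof.
pose C i : pred 'I_q.+1 := if i \in T then pred1 ord0 else predT.
have CE i x : (x \in C i) = ((i \in T) ==> (x == ord0)).
  by rewrite /C; case: (i \in T).
have -> : #|[set f : {ffun I -> 'I_q.+1} | [forall i in T, f i == ord0]]| =
  (\prod_i #|C i|)%N.
  transitivity #|family C|; last by rewrite card_family foldrE big_image.
  apply: eq_card => f; rewrite inE; apply/forallP/forallP => h i; last by rewrite -CE; exact: h.
  by change (f i \in C i); rewrite CE.
rewrite (bigID (mem T)) /= big1 ?mul1n; last by move=> i iT; rewrite /C iT card1.
rewrite (eq_bigr (fun=> q.+1)); last first.
  by move=> i iT; rewrite /C (negbTE iT) card_ord.
rewrite prod_nat_const -expnD; congr (_ ^ _)%N.
by rewrite addnC -(cardC (mem T)).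
Qed.

Lemma sum_card_exchange (A B : finType) (X : {set B}) (P : A -> B -> bool) :
  (\sum_a #|[set b in X | P a b]| = \sum_(b in X) #|[set a | P a b]|)%N.
Proof.
under eq_bigr => a _ do rewrite -sum1dep_card.
under [RHS]eq_bigr => b _ do rewrite -sum1dep_card.
rewrite (exchange_big_dep (mem X)) /= => [|a b _ /andP[] //].
by apply: eq_bigr => b bX; apply: eq_bigl => a; rewrite bX.
Qed.

Section Crossing.
Variables (R : realFieldType) (V W : finType).
Variables (px py : V -> R) (l r : W -> V) (sl ic : W -> R).
Variables (S : {set V}) (F : {set W}).

Let ev (e : W) (x : R) := sl e * x + ic e.

Hypothesis points_inj :
  {in S &, forall u v, px u = px v -> py u = py v -> u = v}.
Hypothesis edge_inj : {in F &, forall e f, l e = l f -> r e = r f -> e = f}.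
Hypothesis edge_lr : {in F, forall e, px (l e) < px (r e)}.
Hypothesis edge_lS : {in F, forall e, l e \in S}.
Hypothesis edge_rS : {in F, forall e, r e \in S}.
Hypothesis edge_l : {in F, forall e, py (l e) = ev e (px (l e))}.
Hypothesis edge_r : {in F, forall e, py (r e) = ev e (px (r e))}.
Hypothesis edge_empty : {in F & S, forall e v,
  px (l e) < px v -> px v < px (r e) -> py v != ev e (px v)}.

(** Here [x] is the abscissa at which the two carrying lines meet; computing it makes the relation
    boolean, so that crossing pairs can be counted. *)
Definition crossing (e f : W) : bool :=
  let x := (ic f - ic e) / (sl e - sl f) in
  [&& sl e != sl f, px (l e) < x, x < px (r e), px (l f) < x & x < px (r f)].

Lemma crossing_meet (e f : W) : crossing e f -> exists x,
  [/\ sl e != sl f, ev e x = ev f x, px (l e) < x < px (r e) &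
      px (l f) < x < px (r f)].
Proof.
rewrite /crossing; set x := _ / _ => /and5P[s h1 h2 h3 h4].
exists x; rewrite h1 h2 h3 h4 s; split => //.
have : x * (sl e - sl f) = ic f - ic e by rewrite divfK ?subr_eq0.
by rewrite /ev; lra.
Qed.

(** Only equal slopes need an argument: overlapping edges on one line have no vertex in their
    interiors, hence have the same ends and are equal. *)
Lemma meet_crossing (e f : W) x : e \in F -> f \in F -> e != f ->
  px (l e) < x -> x < px (r e) -> px (l f) < x -> x < px (r f) ->
  ev e x = ev f x -> crossing e f.
Proof.
move=> eF fF nef e1 e2 f1 f2 E.
have [s|s] := eqVneq (sl e) (sl f); last first.
  rewrite /crossing s; have -> : (ic f - ic e) / (sl e - sl f) = x.
    apply: (@mulIf _ (sl e - sl f)); rewrite ?subr_eq0 // divfK ?subr_eq0 //.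
    by move: E; rewrite /ev; lra.
  by rewrite e1 e2 f1 f2.
have i : ic e = ic f by move: E; rewrite /ev s => /addrI.
have evE y : ev e y = ev f y by rewrite /ev s i.
case/eqP: nef; apply: edge_inj => //.
  have [h|h|h] := ltgtP (px (l e)) (px (l f)).
  - have /eqP[] := edge_empty eF (edge_lS fF) h ltac:(lra).
    by rewrite edge_l // evE.
  - have /eqP[] := edge_empty fF (edge_lS eF) h ltac:(lra).
    by rewrite edge_l // evE.
  - by apply: points_inj; rewrite ?edge_lS // !edge_l // evE h.
have [h|h|h] := ltgtP (px (r e)) (px (r f)).
- have /eqP[] := edge_empty fF (edge_rS eF) ltac:(lra) h.
  by rewrite edge_r // evE.
- have /eqP[] := edge_empty eF (edge_rS fF) ltac:(lra) h.
  by rewrite edge_r // evE.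
- by apply: points_inj; rewrite ?edge_rS // !edge_r // evE h.
Qed.

(** Deleting every edge that crosses another leaves a plane graph, and each deleted edge is the
    first component of a crossing pair. *)
Lemma card_le_crossing (S' : {set V}) (F' : {set W}) :
  S' \subset S -> F' \subset F ->
  {in F', forall e, (l e \in S') && (r e \in S')} ->
  (#|F'| <= 4 * #|S'| + #|[set p in setX F' F' | crossing p.1 p.2]|)%N.
Proof.
move=> /subsetP sS /subsetP sF F'S.
pose G := [set e in F' | [exists f in F', crossing e f]].
have Gle : (#|G| <= #|[set p in setX F' F' | crossing p.1 p.2]|)%N.
  apply: (@card_le_rel _ _ _ _ (fun e p => e = p.1)).
    move=> e; rewrite inE => /andP[eF /existsP[f /andP[fF ef]]].
    by exists (e, f); rewrite // !inE eF fF ef.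
  by move=> e1 e2 _ _ p -> ->.
rewrite -(cardsID G F') addnC leq_add //; last first.
  by apply: leq_trans Gle; rewrite subset_leq_card // subsetIr.
apply: (@card_plane_graph R V W px py l r sl ic S' (F' :\: G)).
- by move=> u v uS vS; apply: points_inj; apply: sS.
- by move=> e /setDP[/sF eF _]; apply: edge_lr.
- by move=> e /setDP[/F'S/andP[]].
- by move=> e /setDP[/F'S/andP[]].
- by move=> e /setDP[/sF eF _]; apply: edge_l.
- by move=> e /setDP[/sF eF _]; apply: edge_r.
- by move=> e v /setDP[/sF eF _] /sS vS; apply: edge_empty.
move=> e f /setDP[eF eG] /setDP[fF _] nef x e1 e2 f1 f2.
apply: contra eG => /eqP E; rewrite inE eF /=; apply/existsP; exists f.
by rewrite fF (@meet_crossing e f x) // ?sF.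
Qed.

(** Edges with a common left or right end meet only there. Four distinct ends are what gives a
    crossing the survival probability [q^(-4)] in a random sample. *)
Lemma crossing_ends (e f : W) : e \in F -> f \in F -> crossing e f ->
  #|[set l e; r e; l f; r f]| = 4%N.
Proof.
move=> eF fF /crossing_meet[x [s E /andP[e1 e2] /andP[f1 f2]]].
have lle : l e != l f.
  apply: contraNneq s => lE; have := edge_l fF; rewrite -lE edge_l // => E'.
  apply/eqP/le_anti; rewrite !leNgt.
  rewrite -(affine_lt_right (esym E') e1) -(affine_lt_right E' e1).
  by move: E; rewrite /ev => ->; rewrite ltxx.
have rre : r e != r f.
  apply: contraNneq s => rE; have := edge_r fF; rewrite -rE edge_r // => E'.
  apply/eqP/le_anti; rewrite !leNgt.
  rewrite -(affine_lt_left (esym E') e2) -(affine_lt_left E' e2).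
  by move: E; rewrite /ev => ->; rewrite ltxx.
have px_neq u v : px u < px v -> u != v by apply: contraTneq => ->; rewrite ltxx.
have lr : l e != r e by apply/px_neq/edge_lr.
have lr' : l f != r f by apply/px_neq/edge_lr.
have lr'' : l e != r f by apply/px_neq; lra.
have lr''' : l f != r e by apply/px_neq; lra.
rewrite -!setUA !cardsU1 cards1 !inE.
by rewrite !negb_or lle lr lr'' rre lr' eq_sym lr'''.
Qed.

(** At density [1/q] a vertex, an edge and a crossing survive with probability [q^(-1)], [q^(-2)]
    and [q^(-4)]. Average [card_le_crossing] over all samples and multiply by [q^4]. *)
Lemma crossing_lemma (q : nat) : (0 < q)%N ->
  (q ^ 2 * #|F| <= 4 * q ^ 3 * #|S| +
     #|[set p in setX F F | crossing p.1 p.2]|)%N.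
Proof.
case: q => // q _; set X := [set p in _ | _].
pose T := {ffun V -> 'I_q.+1}.
pose z (w : T) v := w v == ord0.
pose Sw w := [set v in S | z w v].
pose Fw w := [set e in F | z w (l e) && z w (r e)].
pose Xw w := [set p in X | [&& z w (l p.1), z w (r p.1), z w (l p.2) & z w (r p.2)]].
have h w : (#|Fw w| <= 4 * #|Sw w| + #|Xw w|)%N.
  have -> : Xw w = [set p in setX (Fw w) (Fw w) | crossing p.1 p.2].
    apply/setP => p; rewrite !inE -!andbA.
    by do ![case: (_ \in _); rewrite ?andbF //=]; do ![case: (z _ _); rewrite ?andbF ?andbT //=].
  apply: card_le_crossing; first by apply/subsetP => v; rewrite inE => /andP[].
    by apply/subsetP => v; rewrite inE => /andP[].
  by move=> e; rewrite !inE => /and3P[eF -> ->]; rewrite edge_lS ?edge_rS.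
have : (\sum_w #|Fw w| <= \sum_w (4 * #|Sw w| + #|Xw w|))%N by apply: leq_sum.
rewrite big_split -big_distrr /= !sum_card_exchange.
have cT (Y : {set V}) (P : T -> bool) : (forall w, P w = [forall i in Y, w i == ord0]) ->
    (#|[set w | P w]| * q.+1 ^ #|Y| = q.+1 ^ #|V|)%N.
  by move=> PE; rewrite -(card_ffun_eq0 q Y); congr (#|pred_of_set _| * _)%N; apply/setP=> w; rewrite !inE PE.
have hF e : e \in F -> (#|[set w : T | z w (l e) && z w (r e)]| * q.+1 ^ 2 = q.+1 ^ #|V|)%N.
  move=> eF; rewrite -(cT [set l e; r e] (fun w => z w (l e) && z w (r e))).
    by rewrite cards2; case: eqP (edge_lr eF) => // ->; rewrite ltxx.
  move=> w; apply/andP/forall_inP => [[h1 h2] v|hv].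
    by rewrite !inE => /orP[] /eqP ->.
  by split; apply: hv; rewrite !inE eqxx ?orbT.
have hS v : v \in S -> (#|[set w : T | z w v]| * q.+1 = q.+1 ^ #|V|)%N.
  move=> vS; rewrite -(cT [set v] (fun w => z w v)) ?cards1 ?expn1 //.
  by move=> w; apply/idP/forall_inP => [h1 u /set1P -> //|]; apply; rewrite inE.
have hX p : p \in X -> (#|[set w : T | [&& z w (l p.1), z w (r p.1), z w (l p.2) & z w (r p.2)]]| * q.+1 ^ 4 = q.+1 ^ #|V|)%N.
  rewrite !inE => /andP[/andP[p1 p2] cp].
  rewrite -(cT [set l p.1; r p.1; l p.2; r p.2] (fun w => [&& z w (l p.1), z w (r p.1), z w (l p.2) & z w (r p.2)])).
    by rewrite crossing_ends.
  move=> w; apply/and4P/forall_inP => [[h1 h2 h3 h4] v|hv].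
    by rewrite !inE -!orbA => /or4P[] /eqP ->.
  by split; apply: hv; rewrite !inE eqxx ?orbT.
(* Times [q.+1 ^ 4], every summand becomes a power of [q.+1] times the number [q.+1 ^ #|V|] of
   samples, which then cancels. *)
move=> hsum; have := leq_mul hsum (leqnn (q.+1 ^ 4)%N).
rewrite mulnDl -mulnA !big_distrl /=.
rewrite (eq_bigr (fun=> q.+1 ^ #|V| * q.+1 ^ 2)%N); last first.
  by move=> e eF; rewrite -(hF e eF) -mulnA -expnD.
rewrite [X in (_ <= 4 * X + _)%N](eq_bigr (fun=> q.+1 ^ #|V| * q.+1 ^ 3)%N); last first.
  by move=> e eF; rewrite -(hS e eF) -mulnA -expnS.
rewrite [X in (_ <= _ + X)%N](eq_bigr (fun=> q.+1 ^ #|V|)%N); last first.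
  by move=> e eF; rewrite hX.
rewrite !sum_nat_const.
move=> hh; rewrite -(leq_pmul2l (m := q.+1 ^ #|V|)) ?expn_gt0 //.
have -> : (q.+1 ^ #|V| * (q.+1 ^ 2 * #|F|) = #|F| * (q.+1 ^ #|V| * q.+1 ^ 2))%N.
  by lia.
apply: leq_trans hh _; rewrite leq_eqVlt; apply/orP; left; apply/eqP.
by move: (q.+1 ^ #|V|)%N (q.+1 ^ 3)%N => N Q; ring.
Qed.

End Crossing.

(** * The Szemeredi-Trotter theorem *)

Section SzemerediTrotter.
Variables (R : realFieldType) (I J : finType).
Variables (px py : I -> R) (la lb : J -> R).
Variables (A : {set I}) (B : {set J}).

Let on i j := py i == la j * px i + lb j.

Hypothesis points_inj :
  {in A &, forall u v, px u = px v -> py u = py v -> u = v}.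
Hypothesis lines_inj :
  {in B &, forall u v, la u = la v -> lb u = lb v -> u = v}.

Let inc : {set I * J} := [set p in setX A B | on p.1 p.2].

Let edges : {set J * (I * I)} :=
  [set w | [&& w.1 \in B, w.2.1 \in A, w.2.2 \in A & px w.2.1 < px w.2.2] &&
    [&& on w.2.1 w.1, on w.2.2 w.1 &
      [forall v in A, ~~ [&& on v w.1, px w.2.1 < px v & px v < px w.2.2]]]].

(** An incidence that is not the last on its line starts an edge to the next point; there is at most
    one last incidence per line. *)
Lemma card_inc_le_edges : (#|inc| <= #|B| + #|edges|)%N.
Proof.
pose L := [set p in inc | [exists v in A, on v p.2 && (px p.1 < px v)]].
rewrite -(cardsID L inc) addnC leq_add //.
  apply: (@card_le_rel _ _ _ _ (fun p b => p.2 = b)).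
    by move=> [i j]; rewrite !inE /= => /andP[_ /andP[/andP[_ jB] _]]; exists j.
  move=> [i1 j1] [i2 j2]; rewrite !inE /= => /andP[h1 /andP[/andP[a1 b1] o1]].
  move=> /andP[h2 /andP[/andP[a2 b2] o2]] b E1 E2.
  rewrite E1 in h1 b1 o1 *; rewrite E2 in h2 b2 o2 *.
  have E : px i1 = px i2.
    apply/le_anti; rewrite !leNgt; apply/andP; split.
      apply: contra h2 => h; rewrite a2 b2 o2 /=; apply/existsP; exists i1.
      by rewrite a1 o1.
    apply: contra h1 => h; rewrite a1 b1 o1 /=; apply/existsP; exists i2.
    by rewrite a2 o2.
  congr pair; apply: points_inj => //.
  by rewrite (eqP o1) (eqP o2) E.
apply: leq_trans (subset_leq_card (subsetIr _ _)) _.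
apply: (@card_le_rel _ _ _ _ (fun p w => p = (w.2.1, w.1))).
  move=> [i j]; rewrite !inE /= => /andP[/andP[/andP[a b] o]].
  move=> /existsP[v0 v0P].
  have [v /and3P[va vo iv] vmin] :=
    arg_minP px (P := fun v => [&& v \in A, on v j & px i < px v]) v0P.
  exists (j, (i, v)) => //; rewrite !inE /= a b va iv o vo /=.
  apply/forall_inP => u ua; apply/negP => /and3P[uo iu uv].
  by have := vmin u; rewrite ua uo iu leNgt uv => /(_ isT).
by move=> p1 p2 _ _ w -> ->.
Qed.

Let slp (w : J * (I * I)) := la w.1.
Let icp (w : J * (I * I)) := lb w.1.
Let lft (w : J * (I * I)) := w.2.1.
Let rgt (w : J * (I * I)) := w.2.2.

Let cross := crossing px lft rgt slp icp.

Lemma two_points_line (u v : I) (j k : J) : j \in B -> k \in B ->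
  px u < px v -> on u j -> on v j -> on u k -> on v k -> j = k.
Proof.
move=> jB kB uv /eqP uj /eqP vj /eqP uk /eqP vk.
have aE : la j = la k.
  have : (la j - la k) * (px v - px u) = 0 by lra.
  by move/eqP; rewrite mulf_eq0 !subr_eq0 (gt_eqF uv) orbF => /eqP.
by apply: lines_inj => //; move: uj; rewrite uk aE => /addrI.
Qed.

Lemma edges_props : [/\ {in edges &, forall e f, lft e = lft f -> rgt e = rgt f -> e = f},
  {in edges, forall e, px (lft e) < px (rgt e)},
  {in edges, forall e, lft e \in A}, {in edges, forall e, rgt e \in A} &
  [/\ {in edges, forall e, py (lft e) = slp e * px (lft e) + icp e},
      {in edges, forall e, py (rgt e) = slp e * px (rgt e) + icp e} &
      {in edges & A, forall e v, px (lft e) < px v -> px v < px (rgt e) ->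
         py v != slp e * px v + icp e}]].
Proof.
split; last split.
- move=> [j [u v]] [k [u' v']]; rewrite !inE /lft /rgt /=.
  move=> /andP[/and4P[b a a' uv] /and3P[ul vl _]].
  move=> /andP[/and4P[b' a1 a1' uv'] /and3P[ul' vl' _]] E1 E2.
  rewrite -E1 -E2 in ul' vl' *; congr (_, (_, _)).
  exact: (two_points_line b b' uv).
- by move=> e; rewrite inE => /andP[/and4P[]].
- by move=> e; rewrite inE => /andP[/and4P[]].
- by move=> e; rewrite inE => /andP[/and4P[]].
- by move=> e; rewrite inE => /andP[_ /and3P[/eqP]].
- by move=> e; rewrite inE => /andP[_ /and3P[_ /eqP]].
move=> e v; rewrite inE => /andP[_ /and3P[_ _ /forall_inP h]] /h.
by rewrite !negb_and -/(lft e) -/(rgt e) => /or3P[//|/negP|/negP].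
Qed.

(** Two lines meet in one point, which is interior to at most one edge of each. So the pair of lines
    determines the crossing pair of edges. *)
Lemma card_crossing_le : (#|[set p in setX edges edges | cross p.1 p.2]| <= #|B| ^ 2)%N.
Proof.
have [ei elr elS erS [el er ee]] := edges_props.
rewrite -mulnn -cardsX.
apply: (@card_le_rel _ _ _ _ (fun p b => p.1.1 = b.1 /\ p.2.1 = b.2)).
  move=> [e f]; rewrite !inE /= => /andP[/andP[/andP[/andP[b _] _]]].
  by move=> /andP[/andP[b' _] _] _; exists (e.1, f.1); rewrite // !inE b b'.
move=> [e1 f1] [e2 f2] /setIdP[/setXP[/= e1F f1F] c1] /setIdP[/setXP[/= e2F f2F] c2].
move=> [b1 b2] /= [E1 E2] [E1' E2'].
have [x [s1 x1 /andP[h1 h1'] /andP[g1 g1']]] := crossing_meet c1.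
have [y [s2 y1 /andP[h2 h2'] /andP[g2 g2']]] := crossing_meet c2.
rewrite /slp /icp E1 E2 E1' E2' in s1 x1 s2 y1.
have xy : x = y.
  have : (la b1 - la b2) * (x - y) = 0 by lra.
  by move/eqP; rewrite mulf_eq0 !subr_eq0 (negbTE s1) => /eqP.
rewrite -{}xy in h2 h2' g2 g2' y1.
have same e e' : e \in edges -> e' \in edges -> e.1 = e'.1 ->
    px (lft e) < x -> x < px (rgt e) -> px (lft e') < x -> x < px (rgt e') -> e = e'.
  move=> eF e'F E a1 a2 a3 a4; apply/eqP/negP => /negP ne.
  have : crossing px lft rgt slp icp e e'.
    apply: (meet_crossing points_inj ei elS erS el er ee eF e'F ne a1 a2 a3 a4).
    by rewrite /slp /icp E.
  by case/crossing_meet => z []; rewrite /slp E eqxx.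
by congr pair; apply: same => //; rewrite ?E1 ?E1' ?E2 ?E2'.
Qed.

(* For a free integer parameter [q]; optimizing it gives the usual bound
   [m^(2/3) n^(2/3) + m + n]. *)
Lemma szemeredi_trotter (q : nat) : (0 < q)%N ->
  (q ^ 2 * #|inc| <= q ^ 2 * #|B| + 4 * q ^ 3 * #|A| + #|B| ^ 2)%N.
Proof.
move=> q0; have [ei elr elS erS [el er ee]] := edges_props.
have := crossing_lemma points_inj ei elr elS erS el er ee q0.
move=> h; have := leq_mul (leqnn (q ^ 2)%N) card_inc_le_edges.
rewrite mulnDr -addnA => h'; apply: leq_trans h' _; rewrite leq_add2l.
by apply: leq_trans h _; rewrite leq_add2l card_crossing_le.
Qed.

End SzemerediTrotter.

(** * Incidences in homogeneous coordinates *)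

Lemma poly_nonroot (R : realFieldType) (P : {poly R}) :
  P != 0 -> exists s, P.[s] != 0.
Proof.
(* These [size P] distinct values cannot all be roots. *)
move=> P0; pose rs : seq R := [seq i%:R | i <- iota 0 (size P)].
have [/allP h|] := boolP (all (root P) rs).
  have u : uniq rs by rewrite map_inj_uniq ?iota_uniq // => i j /eqP; rewrite eqr_nat => /eqP.
  have := max_poly_roots P0 (introT allP h) u.
  by rewrite size_map size_iota ltnn.
by case/allPn => s _ ns; exists s.
Qed.

Lemma Poly_neq0 (R : realFieldType) (s : seq R) (i : nat) :
  nth 0 s i != 0 -> Poly s != 0.
Proof. by apply: contraNneq => P0; rewrite -coef_Poly P0 coef0. Qed.

Section HomogeneousSzemerediTrotter.
Variables (R : realFieldType) (I J : finType).
Variables (p0 p1 p2 : I -> R) (r0 r1 r2 : J -> R).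
Variables (A : {set I}) (B : {set J}).

Hypothesis p_neq0 : {in A, forall i, ~~ [&& p0 i == 0, p1 i == 0 & p2 i == 0]}.
Hypothesis r_neq0 : {in B, forall j, ~~ [&& r0 j == 0, r1 j == 0 & r2 j == 0]}.
Hypothesis p_nonpar : {in A &, forall i j c,
  p0 j = c * p0 i -> p1 j = c * p1 i -> p2 j = c * p2 i -> i = j}.
Hypothesis r_nonpar : {in B &, forall i j c,
  r0 j = c * r0 i -> r1 j = c * r1 i -> r2 j = c * r2 i -> i = j}.

(* The shears of the first family and the dual shears of the second one
   bring both into an affine chart in which no line is vertical. *)
Lemma generic_shear : exists s,
  {in A, forall i, p2 i + s * p1 i + s ^+ 2 * p0 i != 0} /\
  {in B, forall j, r1 j - s * r2 j - s ^+ 4 * (r0 j - s ^+ 2 * r2 j) != 0}.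
Proof.
(* The powers of [s] are spread so that every coordinate is, up to sign, a coefficient by itself; a
   nonzero vector thus gives a nonzero polynomial, and one [s] avoids the roots of all of them. *)
pose P i := Poly [:: p2 i; p1 i; p0 i].
pose Q j := Poly [:: r1 j; - r2 j; 0; 0; - r0 j; 0; r2 j].
have PE i s : p2 i + s * p1 i + s ^+ 2 * p0 i = (P i).[s].
  by rewrite horner_Poly /=; ring.
have QE j s : r1 j - s * r2 j - s ^+ 4 * (r0 j - s ^+ 2 * r2 j) = (Q j).[s].
  by rewrite horner_Poly /=; ring.
have /poly_nonroot [s] : (\prod_(i in A) P i) * (\prod_(j in B) Q j) != 0.
  apply: mulf_neq0; apply/prodf_neq0 => i iS.
    have := p_neq0 iS; rewrite !negb_and => /or3P[] h.
    - exact: (@Poly_neq0 _ _ 2).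
    - exact: (@Poly_neq0 _ _ 1).
    - exact: (@Poly_neq0 _ _ 0).
  have := r_neq0 iS; rewrite !negb_and => /or3P[] h.
  - by apply: (@Poly_neq0 _ _ 4); rewrite /= oppr_eq0.
  - exact: (@Poly_neq0 _ _ 0).
  - exact: (@Poly_neq0 _ _ 6).
rewrite hornerM mulf_eq0 negb_or !horner_prod => /andP[/prodf_neq0 hA /prodf_neq0 hB].
exists s; split => i iS; first by rewrite PE hA.
by rewrite QE hB.
Qed.

(** The shears preserve the bilinear form, and [P2] and [Q1] do not vanish. Dividing by them gives
    affine points and nonvertical lines with the same incidences. *)
Lemma szemeredi_trotter_dual (q : nat) : (0 < q)%N ->
  (q ^ 2 * #|[set p in setX A B |
        (p0 p.1 * r0 p.2 + p1 p.1 * r1 p.2 + p2 p.1 * r2 p.2 == 0)%R]|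
   <= q ^ 2 * #|B| + 4 * q ^ 3 * #|A| + #|B| ^ 2)%N.
Proof.
move=> q_gt0; have [s [hA hB]] := generic_shear.
pose P2 i := p2 i + s * p1 i + s ^+ 2 * p0 i.
pose P0 i := p0 i + s ^+ 4 * p1 i.
pose Q0 j := r0 j - s ^+ 2 * r2 j.
pose Q1 j := r1 j - s * r2 j - s ^+ 4 * Q0 j.
have dotE i j : p0 i * r0 j + p1 i * r1 j + p2 i * r2 j =
    P0 i * Q0 j + p1 i * Q1 j + P2 i * r2 j.
  by rewrite /P0 /Q0 /P2 /Q1 /Q0; ring.
pose px i := P0 i / P2 i; pose py i := p1 i / P2 i.
pose la j := - (Q0 j / Q1 j); pose lb j := - (r2 j / Q1 j).
have pinj : {in A &, forall u v, px u = px v -> py u = py v -> u = v}.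
  move=> u v uA vA hx hy; have Pu := hA _ uA; have Pv := hA _ vA.
  rewrite -/(P2 u) in Pu; rewrite -/(P2 v) in Pv.
  have e0 : P0 v = P2 v / P2 u * P0 u.
    by rewrite mulrAC -mulrA -/(px u) hx /px mulrC divfK.
  have e1 : p1 v = P2 v / P2 u * p1 u.
    by rewrite mulrAC -mulrA -/(py u) hy /py mulrC divfK.
  have e2 : P2 v = P2 v / P2 u * P2 u by rewrite divfK.
  have e0' : p0 v = P2 v / P2 u * p0 u.
    have -> : p0 v = P0 v - s ^+ 4 * p1 v by rewrite /P0; ring.
    by rewrite e0 e1 /P0; ring.
  apply: (p_nonpar uA vA e0' e1).
  have -> : p2 v = P2 v - s * p1 v - s ^+ 2 * p0 v by rewrite /P2; ring.
  by rewrite {1}e2 e1 e0'; move: (P2 v / P2 u) => c; rewrite /P2; ring.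
have linj : {in B &, forall u v, la u = la v -> lb u = lb v -> u = v}.
  move=> u v uA vA /oppr_inj hx /oppr_inj hy; have Pu := hB _ uA; have Pv := hB _ vA.
  rewrite -/(Q0 u) -/(Q1 u) in Pu; rewrite -/(Q0 v) -/(Q1 v) in Pv.
  have e0 : Q0 v = Q1 v / Q1 u * Q0 u.
    by rewrite mulrAC -mulrA hx mulrC divfK.
  have e2 : r2 v = Q1 v / Q1 u * r2 u.
    by rewrite mulrAC -mulrA hy mulrC divfK.
  have e1 : Q1 v = Q1 v / Q1 u * Q1 u by rewrite divfK.
  have e0' : r0 v = Q1 v / Q1 u * r0 u.
    have -> : r0 v = Q0 v + s ^+ 2 * r2 v by rewrite /Q0; ring.
    by rewrite e0 e2 /Q0; ring.
  apply: (r_nonpar uA vA e0' _ e2).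
  have -> : r1 v = Q1 v + s * r2 v + s ^+ 4 * Q0 v by rewrite /Q1; ring.
  by rewrite {1}e1 e2 e0; move: (Q1 v / Q1 u) => c; rewrite /Q1; ring.
have := szemeredi_trotter pinj linj q_gt0.
congr (_ * _ <= _)%N; apply: eq_card => -[i j]; rewrite !inE /=.
have [/andP[iA jB]|//] := boolP ((i \in A) && (j \in B)) => /=.
have Pi : P2 i != 0 by apply: hA.
have Qj : Q1 j != 0 by apply: hB.
rewrite dotE.
have -> : P0 i * Q0 j + p1 i * Q1 j + P2 i * r2 j =
    P2 i * Q1 j * (py i - (la j * px i + lb j)).
  by rewrite /py /px /la /lb; field; rewrite Pi Qj.
by rewrite mulf_eq0 (negbTE (mulf_neq0 Pi Qj)) subr_eq0.
Qed.

End HomogeneousSzemerediTrotter.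

(** * Lines in space *)

Lemma cross_eq0_scale (R : realFieldType) (a0 a1 a2 b0 b1 b2 : R) :
  ~~ [&& a0 == 0, a1 == 0 & a2 == 0] ->
  a1 * b2 = a2 * b1 -> a2 * b0 = a0 * b2 -> a0 * b1 = a1 * b0 ->
  exists c, [/\ b0 = c * a0, b1 = c * a1 & b2 = c * a2].
Proof.
rewrite !negb_and => /or3P[] nz h0 h1 h2.
- exists (b0 / a0); split; rewrite mulrAC ?mulfK //.
    by rewrite [b0 * a1]mulrC -h2 mulrC mulKf.
  by rewrite [b0 * a2]mulrC h1 mulrC mulKf.
- exists (b1 / a1); split; rewrite mulrAC ?mulfK //.
    by rewrite [b1 * a0]mulrC h2 mulrC mulKf.
  by rewrite [b1 * a2]mulrC -h0 mulrC mulKf.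
- exists (b2 / a2); split; rewrite mulrAC ?mulfK //.
    by rewrite [b2 * a0]mulrC -h1 mulrC mulKf.
  by rewrite [b2 * a1]mulrC h0 mulrC mulKf.
Qed.

Section SpaceLines.
Variables (R : realFieldType) (T : finType) (X Y Z : T -> R).

Hypothesis xyz_inj : forall u v, X u = X v -> Y u = Y v -> Z u = Z v -> u = v.

(** Vanishing of the cross product of [v - u] and [w - u]. It holds for every [w] if [u = v], so
    distinctness is required separately. *)
Definition collinear (u v w : T) : bool :=
  [&& (Y v - Y u) * (Z w - Z u) == (Z v - Z u) * (Y w - Y u),
      (Z v - Z u) * (X w - X u) == (X v - X u) * (Z w - Z u) &
      (X v - X u) * (Y w - Y u) == (Y v - Y u) * (X w - X u)].

Definition line (u v : T) : {set T} := [set w | collinear u v w].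

(** A line is represented by the points of [T] on it, so that its richness is a cardinality; only
    lines spanned by two points occur. *)
Definition lines : {set {set T}} :=
  [set line p.1 p.2 | p in [set p : T * T | p.1 != p.2]].

Lemma collinear_ex (u v w : T) : u != v -> collinear u v w -> exists c,
  [/\ X w = X u + c * (X v - X u), Y w = Y u + c * (Y v - Y u) &
      Z w = Z u + c * (Z v - Z u)].
Proof.
move=> uv /and3P[/eqP h1 /eqP h2 /eqP h3].
have nz : ~~ [&& X v - X u == 0, Y v - Y u == 0 & Z v - Z u == 0].
  apply: contra uv; rewrite !subr_eq0 => /and3P[/eqP hx /eqP hy /eqP hz].
  by apply/eqP/xyz_inj.
have [c [c0 c1 c2]] := cross_eq0_scale nz h1 h2 h3.
by exists c; rewrite -c0 -c1 -c2; split; ring.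
Qed.

Lemma ex_collinear (u v w : T) c :
  X w = X u + c * (X v - X u) -> Y w = Y u + c * (Y v - Y u) ->
  Z w = Z u + c * (Z v - Z u) -> collinear u v w.
Proof. by move=> h1 h2 h3; rewrite /collinear h1 h2 h3; apply/and3P; split; apply/eqP; ring. Qed.

Lemma line_l (u v : T) : u \in line u v.
Proof. by rewrite inE; apply: (@ex_collinear _ _ _ 0); ring. Qed.

Lemma line_r (u v : T) : v \in line u v.
Proof. by rewrite inE; apply: (@ex_collinear _ _ _ 1); ring. Qed.

Lemma line_sub (u v a b : T) : u != v -> a != b ->
  a \in line u v -> b \in line u v -> line a b \subset line u v.
Proof.
move=> uv ab; rewrite !inE => /(collinear_ex uv)[c [c1 c2 c3]].
move=> /(collinear_ex uv)[d [d1 d2 d3]].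
apply/subsetP => w; rewrite !inE => /(collinear_ex ab)[e [e1 e2 e3]].
by apply: (@ex_collinear _ _ _ (c + e * (d - c))); rewrite ?e1 ?e2 ?e3 ?c1 ?c2 ?c3 ?d1 ?d2 ?d3; ring.
Qed.

Lemma line_eq (u v a b : T) : u != v -> a != b ->
  a \in line u v -> b \in line u v -> line a b = line u v.
Proof.
move=> uv ab al bl; apply/eqP; rewrite eqEsubset line_sub //.
have cd : exists c d, [/\ c != d,
    [/\ X a = X u + c * (X v - X u), Y a = Y u + c * (Y v - Y u) & Z a = Z u + c * (Z v - Z u)] &
    [/\ X b = X u + d * (X v - X u), Y b = Y u + d * (Y v - Y u) & Z b = Z u + d * (Z v - Z u)]].
  move: al bl; rewrite !inE => /(collinear_ex uv)[c [c1 c2 c3]].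
  move=> /(collinear_ex uv)[d [d1 d2 d3]]; exists c, d; split=> //.
  by apply: contraNneq ab => E; apply/eqP/xyz_inj; rewrite ?c1 ?c2 ?c3 E ?d1 ?d2 ?d3.
have [c [d [ncd [c1 c2 c3] [d1 d2 d3]]]] := cd.
have dc : d - c != 0 by rewrite subr_eq0 eq_sym.
apply: line_sub => //; rewrite inE.
  by apply: (@ex_collinear _ _ _ (- c / (d - c))); rewrite ?c1 ?c2 ?c3 ?d1 ?d2 ?d3; field.
by apply: (@ex_collinear _ _ _ ((1 - c) / (d - c))); rewrite ?c1 ?c2 ?c3 ?d1 ?d2 ?d3; field.
Qed.

Lemma mem_lines (u v : T) : u != v -> line u v \in lines.
Proof. by move=> uv; apply/imsetP; exists (u, v); rewrite ?inE. Qed.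

Lemma linesP (L : {set T}) : L \in lines -> exists u v,
  [/\ u != v, u \in L, v \in L & L = line u v].
Proof.
case/imsetP => -[u v]; rewrite inE /= => uv ->; exists u, v.
by rewrite line_l line_r.
Qed.

Lemma lines_eq (L : {set T}) (u v : T) : L \in lines -> u != v ->
  u \in L -> v \in L -> L = line u v.
Proof. by case/linesP=> a [b [ab _ _ ->]] uv uL vL; rewrite (line_eq ab uv). Qed.

(** For all but finitely many [s], a projection with coefficients in powers of [s] separates first
    coordinates and keeps noncollinear triples noncollinear. So no line becomes vertical and
    distinct lines stay distinct. *)
Lemma generic_projection : exists px py : T -> R,
  [/\ injective px,
      forall u v w, u != v -> collinear u v w ->
        exists c, px w = px u + c * (px v - px u) /\ py w = py u + c * (py v - py u) &
      forall u v w, (px v - px u) * (py w - py u) = (py v - py u) * (px w - px u) ->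
        collinear u v w].
Proof.
pose P (p : T * T) := Poly [:: X p.2 - X p.1; Y p.2 - Y p.1; Z p.2 - Z p.1].
pose c0 u v w := (Y v - Y u) * (Z w - Z u) - (Z v - Z u) * (Y w - Y u).
pose c1 u v w := (Z v - Z u) * (X w - X u) - (X v - X u) * (Z w - Z u).
pose c2 u v w := (X v - X u) * (Y w - Y u) - (Y v - Y u) * (X w - X u).
have colE u v w : collinear u v w = [&& c0 u v w == 0, c1 u v w == 0 & c2 u v w == 0].
  by rewrite !subr_eq0.
(* The determinant of the projected triple, expanded in powers of [s] with the cross product
   coordinates in its coefficients. *)
pose Q (p : T * T * T) := let: (u, v, w) := p in
  Poly [:: 0; - c2 u v w; c1 u v w + c2 u v w; 0; - c0 u v w - c1 u v w; c0 u v w].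
have /poly_nonroot [s] : (\prod_(p | p.1 != p.2) P p) *
    (\prod_(p | ~~ collinear p.1.1 p.1.2 p.2) Q p) != 0.
  apply: mulf_neq0; apply/prodf_neq0.
    move=> [u v] /= uv.
    have [hx|hx] := eqVneq (X v - X u) 0; last exact: (@Poly_neq0 _ _ 0).
    have [hy|hy] := eqVneq (Y v - Y u) 0; last exact: (@Poly_neq0 _ _ 1).
    have [hz|hz] := eqVneq (Z v - Z u) 0; last exact: (@Poly_neq0 _ _ 2).
    by case/eqP: uv; apply: xyz_inj; lra.
  move=> [[u v] w] nc; have h : ~~ collinear u v w by [].
  rewrite colE !negb_and in h; rewrite /Q.
  have [h2|h2] := eqVneq (c2 u v w) 0; last first.
    by apply: (@Poly_neq0 _ _ 1); rewrite /= oppr_eq0.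
  have [h0|h0] := eqVneq (c0 u v w) 0; last exact: (@Poly_neq0 _ _ 5).
  apply: (@Poly_neq0 _ _ 2); rewrite /= h2 addr0.
  by move: h; rewrite h2 h0 !eqxx orbF.
rewrite hornerM mulf_eq0 negb_or !horner_prod => /andP[/prodf_neq0 hP /prodf_neq0 hQ].
exists (fun u => X u + s * Y u + s ^+ 2 * Z u), (fun u => X u + s ^+ 2 * Y u + s ^+ 4 * Z u).
split.
- move=> u v E; apply/eqP; apply: contraT => uv; have := hP (u, v) uv.
  rewrite /P horner_Poly /= => /eqP[]; transitivity (X v + s * Y v + s ^+ 2 * Z v - (X u + s * Y u + s ^+ 2 * Z u)); first by ring.
  by rewrite E; ring.
- move=> u v w uv /(collinear_ex uv)[c [-> -> ->]]; exists c; split; ring.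
move=> u v w E; apply: contraT => nc; have := hQ (u, v, w) nc.
rewrite /Q horner_Poly /= => /eqP[]; rewrite /c0 /c1 /c2.
by move/eqP: E; rewrite -subr_eq0 => /eqP E; rewrite -[RHS]E; ring.
Qed.

(** Applied to the dual configuration: a line [y = a x + b] becomes the point [(a, b)], and a point
    becomes the line of slope [- px u] and intercept [py u]. So the quadratic term is in the number
    of points. *)
Lemma szemeredi_trotter_lines (B : {set {set T}}) (q : nat) :
  B \subset lines -> (0 < q)%N ->
  (q ^ 2 * \sum_(L in B) #|L| <= q ^ 2 * #|T| + 4 * q ^ 3 * #|B| + #|T| ^ 2)%N.
Proof.
move=> /subsetP sB q0; have [px [py [pxi pcol pcol']]] := generic_projection.
have /fin_all_exists [ab abP] (L : {set T}) : exists ab : R * R,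
    L \in lines -> forall u, u \in L -> py u = ab.1 * px u + ab.2.
  have [LL|_] := boolP (L \in lines); last by exists (0, 0).
  have [u [v [uv _ _ ->]]] := linesP LL.
  have dx : px v - px u != 0 by rewrite subr_eq0 eq_sym (inj_eq pxi).
  exists ((py v - py u) / (px v - px u), py u - (py v - py u) / (px v - px u) * px u) => _ w.
  rewrite inE => /(pcol _ _ _ uv)[c [-> ->]] /=.
  by field.
have abinj : {in B &, forall L M, (ab L).1 = (ab M).1 -> (ab L).2 = (ab M).2 -> L = M}.
  move=> L M LB MB E1 E2; have hL := abP _ (sB _ LB); have hM := abP _ (sB _ MB).
  have [u [v [uv uL vL EL]]] := linesP (sB _ LB).
  have [u' [v' [uv' uM vM EM]]] := linesP (sB _ MB).
  have sub w : w \in M -> w \in line u v.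
    move=> wM; rewrite inE; apply: pcol'.
    by rewrite (hM _ wM) (hL _ uL) (hL _ vL) E1 E2; ring.
  by rewrite EL EM (@line_eq u v u' v') // sub.
have linj : {in [set: T] &, forall u v, - px u = - px v -> py u = py v -> u = v}.
  by move=> u v _ _ /oppr_inj /pxi.
have := @szemeredi_trotter R _ _ (fun L => (ab L).1) (fun L => (ab L).2)
  (fun u => - px u) py B [set: T] abinj linj q q0.
rewrite cardsT; apply: leq_trans; rewrite leq_mul2l; apply/orP; right.
have -> : (\sum_(L in B) #|L| = #|[set p : {set T} * T | (p.1 \in B) && (p.2 \in p.1)]|)%N.
  rewrite -sum1dep_card -(pair_big_dep (fun L => L \in B) (fun L u => u \in L) (fun _ _ => 1%N)) /=.
  by apply: eq_bigr => L _; rewrite sum1_card.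
apply/subset_leq_card/subsetP => -[L u]; rewrite !inE /= => /andP[LB uL].
by rewrite LB /= (abP _ (sB _ LB) _ uL); apply/eqP; ring.
Qed.

Definition rich_lines (k : nat) : {set {set T}} := [set L in lines | (k <= #|L|)%N].

(** Each line carries at least [8 q] incidences, so the term [4 q^3] times the number of lines is at
    most half of the left side and is absorbed. *)
Lemma rich_lines_incidences (q k : nat) : (0 < q)%N -> (8 * q <= k)%N ->
  (q ^ 2 * \sum_(L in rich_lines k) #|L| <= 2 * q ^ 2 * #|T| + 2 * #|T| ^ 2)%N.
Proof.
move=> q0 qk; have sub : rich_lines k \subset lines by apply/subsetP => L; rewrite inE => /andP[].
have := szemeredi_trotter_lines sub q0.
have : (#|rich_lines k| * (8 * q) <= \sum_(L in rich_lines k) #|L|)%N.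
  rewrite -sum_nat_const; apply: leq_sum => L; rewrite inE => /andP[_]; exact: leq_trans.
move: (\sum_(L in _) _)%N #|rich_lines k| #|T| => s m n h1 h2.
have := leq_mul (leqnn (q ^ 2)%N) h1; rewrite !expnS !expn0 in h2 *; nia.
Qed.

(** Lines through [y] are disjoint away from [y]. *)
Lemma card_pencil_pairs (y : T) :
  (\sum_(L in lines | y \in L) #|L :\ y| <= #|T|)%N.
Proof.
have -> : (\sum_(L in lines | y \in L) #|L :\ y| =
    #|[set p : {set T} * T | ((p.1 \in lines) && (y \in p.1)) && (p.2 \in p.1 :\ y)]|)%N.
  rewrite -sum1dep_card -(pair_big_dep (fun L => (L \in lines) && (y \in L)) (fun L u => u \in L :\ y) (fun _ _ => 1%N)) /=.
  by apply: eq_bigr => L _; rewrite sum1_card.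
rewrite -[leqRHS]cardsT; apply: (@card_le_rel _ _ _ _ (fun p u => p.2 = u)).
  by move=> p _; exists p.2.
move=> [L u] [M v]; rewrite !inE /= => /andP[/andP[LL yL] /andP[uy uL]].
move=> /andP[/andP[ML yM] /andP[vy vM]] w E1 E2; rewrite E1 in uL uy *; rewrite E2 in vM vy *.
by congr pair; rewrite (lines_eq LL uy) // (lines_eq ML uy).
Qed.

Lemma card_lines_gt1 (L : {set T}) : L \in lines -> (1 < #|L|)%N.
Proof.
case/linesP=> u [v [uv uL vL _]]; apply: leq_trans (_ : #|[set u; v]| <= _)%N.
  by rewrite cards2 uv.
by apply/subset_leq_card/subsetP => w; rewrite !inE => /orP[] /eqP ->.
Qed.

Lemma card_pencil (y : T) : (\sum_(L in lines | y \in L) #|L| <= 2 * #|T|)%N.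
Proof.
apply: leq_trans (leq_mul (leqnn 2) (card_pencil_pairs y)).
rewrite big_distrr; apply: leq_sum => L /andP[LL yL] /=.
by have := card_lines_gt1 LL; rewrite (cardsD1 y L) yL; lia.
Qed.

Lemma card_rich_pencil (k : nat) (y : T) :
  (k * #|[set L in rich_lines k | y \in L]| <= 2 * #|T|)%N.
Proof.
apply: leq_trans (card_pencil y); rewrite mulnC -sum_nat_const.
rewrite [leqRHS](bigID (fun L : {set T} => k <= #|L|)%N) /=.
apply: leq_trans (leq_addr _ _).
rewrite (eq_bigl (fun L => (L \in lines) && (y \in L) && (k <= #|L|)%N)); last first.
  by move=> L; rewrite !inE andbAC.
by apply: leq_sum => L /andP[].
Qed.

Lemma sum_pencil (B : {set {set T}}) :
  (\sum_y #|[set L in B | y \in L]| = \sum_(L in B) #|L|)%N.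
Proof.
rewrite (sum_card_exchange B (fun y (L : {set T}) => y \in L)).
by apply: eq_bigr => L _; apply: eq_card => y; rewrite inE.
Qed.

End SpaceLines.

(** * Right angles *)

Lemma card_le_cover (A B : finType) (X : {set B}) (P : A -> B -> bool) :
  {in X, forall b, exists a, P a b} ->
  (#|X| <= \sum_a #|[set b in X | P a b]|)%N.
Proof.
move=> h; rewrite sum_card_exchange -sum1_card; apply: leq_sum => b /h[a Pab].
by rewrite card_gt0; apply/set0Pn; exists a; rewrite inE.
Qed.

Lemma card_fiber_le (A B : finType) (X : {set A}) (Y : {set B}) (f : A -> B) k :
  {in X, forall a, f a \in Y} ->
  {in Y, forall b, (#|[set a in X | f a == b]| <= k)%N} -> (#|X| <= k * #|Y|)%N.
Proof.
move=> fY fk; rewrite -sum1_card (partition_big f (mem Y)) //=.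
rewrite mulnC -sum_nat_const; apply: leq_sum => b /fk.
by rewrite -sum1dep_card.
Qed.

Lemma geometric_sum (m : nat) : (7 * \sum_(i < m) 8 ^ i < 8 ^ m)%N.
Proof.
elim: m => [|m IH]; first by rewrite big_ord0.
by rewrite big_ord_recr /= expnS; move: (\sum_(i < m) _)%N (8 ^ m)%N IH => a b; lia.
Qed.

Lemma arith_geometric_sum (m : nat) :
  (\sum_(i < m) i.+1 * 2 ^ (m - i) + 2 * m + 4 = 4 * 2 ^ m)%N.
Proof.
elim: m => [|m IH]; first by rewrite big_ord0.
rewrite big_ord_recr /= subSnn expn1.
rewrite (eq_bigr (fun i : 'I_m => 2 * (i.+1 * 2 ^ (m - i)))%N); last first.
  by move=> i _; rewrite subSn ?(ltnW (ltn_ord i)) // expnS mulnCA.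
rewrite -big_distrr /= expnS.
by move: (\sum_(i < m) _)%N (2 ^ m)%N IH => a b; lia.
Qed.

(** For levels [j <= i <= m], the numbers [x], [y], [z] stand for [2^j], [2^(i-j)], [2^(m-i)]; [s]
    and [s'] are sums of pencil sizes at levels [j] and [i], and [Q] is a sum of squares. This [q]
    balances the last two terms, both of order [n^2 x^2 y^2 z^3] after scaling. *)
Lemma level_arith (x y z n G s s' Q : nat) (q := (x ^ 2 * y ^ 5 * z ^ 3)%N) :
  (0 < x)%N -> (0 < y)%N -> (0 < z)%N ->
  (q ^ 2 * G <= q ^ 2 * s + 4 * q ^ 3 * s' + Q)%N ->
  (x ^ 6 * s <= 130 * n ^ 2)%N -> ((x * y) ^ 6 * s' <= 130 * n ^ 2)%N ->
  (x ^ 9 * Q <= 260 * n ^ 3)%N -> (n <= 512 * (x * y * z) ^ 9)%N ->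
  (x ^ 6 * y ^ 3 * G <= (650 + 260 * 512) * n ^ 2 * (y ^ 3 + x ^ 2 * y ^ 2 * z ^ 3))%N.
Proof.
move=> x0 y0 z0 h hs hs' hQ hn.
have q0 : (0 < q ^ 2)%N by rewrite /q !(expn_gt0, muln_gt0) x0 y0 z0.
have Q1 : (x ^ 6 * y ^ 3 * Q <= q ^ 2 * ((260 * 512) * n ^ 2 * (x ^ 2 * y ^ 2 * z ^ 3)))%N.
  rewrite -(leq_pmul2l (m := x ^ 9)) ?expn_gt0 ?x0 //.
  apply: (@leq_trans (x ^ 6 * y ^ 3 * (260 * n ^ 2 * (512 * (x * y * z) ^ 9))))%N.
    have -> : (x ^ 9 * (x ^ 6 * y ^ 3 * Q) = x ^ 6 * y ^ 3 * (x ^ 9 * Q))%N by ring.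
    rewrite leq_mul2l; apply/orP; right; apply: leq_trans hQ _.
    have -> : (260 * n ^ 3 = 260 * n ^ 2 * n)%N by ring.
    by rewrite leq_mul2l hn orbT.
  by rewrite leq_eqVlt; apply/orP; left; apply/eqP; rewrite /q; ring.
have S1 : (x ^ 6 * y ^ 3 * s <= 130 * n ^ 2 * y ^ 3)%N.
  by rewrite mulnAC leq_mul2r hs orbT.
have S2 : (q * (x ^ 6 * y ^ 3 * s') <= 130 * n ^ 2 * (x ^ 2 * y ^ 2 * z ^ 3))%N.
  have -> : (q * (x ^ 6 * y ^ 3 * s') = ((x * y) ^ 6 * s') * (x ^ 2 * y ^ 2 * z ^ 3))%N.
    by rewrite /q; ring.
  by rewrite leq_mul2r hs' orbT.
rewrite -(leq_pmul2l q0).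
apply: (@leq_trans (x ^ 6 * y ^ 3 * (q ^ 2 * s + 4 * q ^ 3 * s' + Q)))%N.
  by rewrite mulnCA leq_mul2l h orbT.
have -> : (x ^ 6 * y ^ 3 * (q ^ 2 * s + 4 * q ^ 3 * s' + Q) =
   q ^ 2 * (x ^ 6 * y ^ 3 * s) + q ^ 2 * (4 * (q * (x ^ 6 * y ^ 3 * s'))) + x ^ 6 * y ^ 3 * Q)%N by ring.
apply: (@leq_trans (q ^ 2 * (130 * n ^ 2 * y ^ 3) + q ^ 2 * (4 * (130 * n ^ 2 * (x ^ 2 * y ^ 2 * z ^ 3))) +
   q ^ 2 * ((260 * 512) * n ^ 2 * (x ^ 2 * y ^ 2 * z ^ 3))))%N.
  by apply: leq_add => //; apply: leq_add; rewrite !leq_mul2l ?S1 ?S2 !orbT.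
rewrite -!mulnDr leq_mul2l; apply/orP; right.
move: (260 * 512)%N (n ^ 2)%N (y ^ 3)%N (x ^ 2 * y ^ 2 * z ^ 3)%N => C a b c.
by clear; nia.
Qed.

Section RightAngles.
Variables (R : realFieldType) (T : finType) (X Y Z : T -> R).

Hypothesis xyz_inj : forall u v, X u = X v -> Y u = Y v -> Z u = Z v -> u = v.

Local Notation lin := (line X Y Z).
Local Notation lns := (lines X Y Z).
Local Notation rich := (rich_lines X Y Z).

Definition rdot (x y z : T) : R :=
  (X x - X y) * (X z - X y) + (Y x - Y y) * (Y z - Y y) +
  (Z x - Z y) * (Z z - Z y).

Definition right_angle (x y z : T) : bool := [&& x != y, y != z & rdot x y z == 0].

Definition angles : {set T * T * T} := [set p | right_angle p.1.1 p.1.2 p.2].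

Lemma rdotC (x y z : T) : rdot x y z = rdot z y x.
Proof. by rewrite /rdot; ring. Qed.

Lemma rightC (x y z : T) : right_angle x y z = right_angle z y x.
Proof. by rewrite /right_angle rdotC [z == y]eq_sym [y == x]eq_sym andbCA. Qed.

Lemma rdot_self_gt0 (x y : T) : x != y -> 0 < rdot x y x.
Proof.
move=> xy; rewrite /rdot -!expr2 lt_neqAle !addr_ge0 ?sqr_ge0 // andbT eq_sym.
apply: contra xy; rewrite !paddr_eq0 ?addr_ge0 ?sqr_ge0 // !sqrf_eq0 !subr_eq0.
by move=> /andP[/andP[/eqP h1 /eqP h2] /eqP h3]; apply/eqP/xyz_inj.
Qed.

Lemma rdot_scale (x y z x' : T) c : X x' = X y + c * (X x - X y) ->
  Y x' = Y y + c * (Y x - Y y) -> Z x' = Z y + c * (Z x - Z y) ->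
  rdot x' y z = c * rdot x y z.
Proof. by move=> h1 h2 h3; rewrite /rdot h1 h2 h3; ring. Qed.

(* The apex is the orthogonal projection of [z] on the line. *)
Lemma right_apex_uniq (L : {set T}) (x x' y y' z : T) : L \in lns ->
  x \in L -> x' \in L -> y \in L -> y' \in L ->
  right_angle x y z -> right_angle x' y' z -> y = y'.
Proof.
move=> LL xL x'L yL y'L /and3P[xy _ /eqP h] /and3P[xy' _ /eqP h'].
have ym : y' \in lin y x by rewrite -(lines_eq xyz_inj LL _ yL xL) // eq_sym.
have xm : x' \in lin y x by rewrite -(lines_eq xyz_inj LL _ yL xL) // eq_sym.
have yx : y != x by rewrite eq_sym.
move: ym xm; rewrite !inE => /(collinear_ex xyz_inj yx)[c [c1 c2 c3]].
move=> /(collinear_ex xyz_inj yx)[d [d1 d2 d3]].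
have dc : d != c.
  by apply: contraNneq xy' => E; apply/eqP/xyz_inj; rewrite ?c1 ?c2 ?c3 ?d1 ?d2 ?d3 E.
have E : rdot x' y' z = (d - c) * (rdot x y z - c * rdot x y x).
  by rewrite /rdot c1 c2 c3 d1 d2 d3; ring.
have c0 : c = 0.
  move/eqP: E; rewrite h' h sub0r eq_sym mulf_eq0 subr_eq0 (negbTE dc) /=.
  by rewrite oppr_eq0 mulf_eq0 (gt_eqF (rdot_self_gt0 xy)) orbF => /eqP.
by apply: xyz_inj; rewrite ?c1 ?c2 ?c3 c0; ring.
Qed.

Definition pencil (k : nat) (y : T) : {set {set T}} :=
  [set L in rich k | y \in L].

(** A direction for [L] seen from [y]; the default does not occur for a line through [y]. *)
Let mark (y : T) (L : {set T}) : T := odflt y [pick x in L | x != y].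

Lemma markP (y : T) (L : {set T}) : L \in lns -> y \in L ->
  mark y L \in L /\ mark y L != y.
Proof.
move=> LL yL; rewrite /mark; case: pickP => [x /andP[] //|/= h].
have [u [v [uv uL vL _]]] := linesP LL.
have := h u; rewrite uL /= => /negbT; rewrite negbK => /eqP uy.
by have := h v; rewrite vL /= -uy eq_sym uv.
Qed.

Lemma line_mark (y : T) (L : {set T}) : L \in lns -> y \in L ->
  L = lin y (mark y L).
Proof.
by move=> LL yL; have [mL my] := markP LL yL; apply: lines_eq; rewrite // eq_sym.
Qed.

Definition perp (y : T) (L M : {set T}) : bool := rdot (mark y L) y (mark y M) == 0.

Lemma right_perp (x y z : T) : right_angle x y z -> perp y (lin y x) (lin y z).
Proof.
move=> /and3P[xy yz /eqP h].
have yx : y != x by rewrite eq_sym.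
have [m1 _] := markP (mem_lines X Y Z yx) (line_l X Y Z y x).
have [m2 _] := markP (mem_lines X Y Z yz) (line_l X Y Z y z).
move: m1 m2; rewrite !inE => /(collinear_ex xyz_inj yx)[c [c1 c2 c3]].
move=> /(collinear_ex xyz_inj yz)[d [d1 d2 d3]]; rewrite /perp.
by rewrite (rdot_scale _ c1 c2 c3) rdotC (rdot_scale _ d1 d2 d3) rdotC h !mulr0.
Qed.

(** Directions at [y] are points of a projective plane, and a direction is also the normal of the
    projective line of directions orthogonal to it. The first pencil supplies the points, the second
    the lines. *)
Lemma pencil_incidences (y : T) (k k' q : nat) : (0 < q)%N ->
  (q ^ 2 * #|[set p in setX (pencil k y) (pencil k' y) | perp y p.1 p.2]| <=
   q ^ 2 * #|pencil k' y| + 4 * q ^ 3 * #|pencil k y| + #|pencil k' y| ^ 2)%N.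
Proof.
have pl k0 L : L \in pencil k0 y -> L \in lns /\ y \in L.
  by rewrite !inE => /andP[/andP[]].
have nz k0 : {in pencil k0 y, forall L, ~~ [&& X (mark y L) - X y == 0,
    Y (mark y L) - Y y == 0 & Z (mark y L) - Z y == 0]}.
  move=> L /pl[LL yL]; have [_] := markP LL yL; apply: contra.
  by rewrite !subr_eq0 => /and3P[/eqP h1 /eqP h2 /eqP h3]; apply/eqP/xyz_inj.
have np k0 : {in pencil k0 y &, forall L M c,
    X (mark y M) - X y = c * (X (mark y L) - X y) ->
    Y (mark y M) - Y y = c * (Y (mark y L) - Y y) ->
    Z (mark y M) - Z y = c * (Z (mark y L) - Z y) -> L = M}.
  move=> L M /pl[LL yL] /pl[ML yM] c c1 c2 c3.
  have [mM myM] := markP ML yM; have [mL myL] := markP LL yL.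
  have mML : mark y M \in L.
    rewrite (line_mark LL yL) inE; apply: (@ex_collinear _ _ _ _ _ _ _ _ c); lra.
  by rewrite (line_mark ML yM); apply: lines_eq; rewrite // eq_sym.
by apply: (szemeredi_trotter_dual (nz k) (nz k') (np k) (np k')).
Qed.

(** For [i > 0] take [q = 8 ^ (i - 1)] in [rich_lines_incidences]; the constant is
    [130 = 2 + 2 * 64]. Level 0 uses that a pencil has at most [2 n] lines. *)
Lemma rich_level (i : nat) : (64 ^ i <= #|T|)%N ->
  (64 ^ i * \sum_(L in rich (8 ^ i)) #|L| <= 130 * #|T| ^ 2)%N.
Proof.
case: i => [_|i hi].
  rewrite expn0 mul1n -sum_pencil.
  have : (\sum_y #|pencil 1 y| <= \sum_(y : T) 2 * #|T|)%N.
    apply: leq_sum => y _; have := card_rich_pencil xyz_inj 1 y.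
    by rewrite mul1n.
  by rewrite sum_nat_const; move/leq_trans; apply; rewrite -[X in (X * _)%N]/#|T|; nia.
have := @rich_lines_incidences R T X Y Z xyz_inj (8 ^ i) (8 ^ i.+1).
rewrite expn_gt0 expnS leqnn => /(_ isT isT).
rewrite -expnM [(i * 2)%N]mulnC expnM -[(8 ^ 2)%N]/64%N; move: hi; rewrite expnS.
move: (\sum_(L in _) _)%N (64 ^ i)%N #|T| => s a n h1 h2; nia.
Qed.

(** The line of the first leg, the point [x] on it and the point [z] determine the apex, by
    [right_apex_uniq]. *)
Lemma rich_angles_le (k : nat) :
  (#|[set p in angles | (k <= #|lin p.1.2 p.1.1|)%N]| <=
   (\sum_(L in rich k) #|L|) * #|T|)%N.
Proof.
have -> : ((\sum_(L in rich k) #|L|) * #|T| =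
    #|setX [set p : {set T} * T | (p.1 \in rich k) && (p.2 \in p.1)] [set: T]|)%N.
  rewrite cardsX cardsT; congr (_ * _)%N.
  rewrite -sum1dep_card -(pair_big_dep (fun L => L \in rich k) (fun L u => u \in L) (fun _ _ => 1%N)) /=.
  by apply: eq_bigr => L _; rewrite sum1_card.
apply: (@card_le_rel _ _ _ _ (fun p b => [/\ lin p.1.2 p.1.1 = b.1.1, p.1.1 = b.1.2 & p.2 = b.2])).
  move=> [[x y] z] /setIdP[]; rewrite inE /= => /and3P[xy _ _] kL.
  exists ((lin y x, x), z) => //.
  by rewrite in_setX in_setT andbT inE /= inE kL mem_lines 1?eq_sym // line_r.
move=> [[x y] z] [[x' y'] z'] /setIdP[]; rewrite inE /= => p1 _.
move=> /setIdP[]; rewrite inE /= => p2 _.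
move=> [[L v] w] [/= E1 E2 E3] [E1' E2' E3'].
rewrite -E2' -E3' in E2 E3 *; rewrite E2 E3 in p1 E1 *.
have y1 : y \in L by rewrite -E1 line_l.
have y2 : y' \in L by rewrite -E1' line_l.
have x1 : x' \in L by rewrite -E1' line_r.
have LL : L \in lns by rewrite -E1' mem_lines //; case/andP: p2; rewrite eq_sym.
by rewrite (right_apex_uniq LL x1 x1 y1 y2 p1 p2).
Qed.

Definition level (y x : T) : nat := trunc_log 8 #|lin y x|.

Lemma level_le (y x : T) : (8 ^ level y x <= #|lin y x|)%N.
Proof. by apply: trunc_logP => //; apply/card_gt0P; exists y; apply: line_l. Qed.

Lemma level_gt (y x : T) : (#|lin y x| < 8 ^ (level y x).+1)%N.
Proof. exact: trunc_log_ltn. Qed.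

Definition level_angles (i j : nat) : {set T * T * T} :=
  [set p in angles | (level p.1.2 p.1.1 == i) && (level p.1.2 p.2 == j)].

Definition perp_pencil (i j : nat) (y : T) : {set {set T} * {set T}} :=
  [set p in setX (pencil (8 ^ i) y) (pencil (8 ^ j) y) | perp y p.1 p.2].

(** An apex with a perpendicular pair of lines through it carries at most as many angles as there
    are pairs of points on the two lines. *)
Lemma level_angles_perp (i j : nat) :
  (#|level_angles i j| <= 8 ^ i.+1 * 8 ^ j.+1 * \sum_y #|perp_pencil i j y|)%N.
Proof.
apply: leq_trans (card_le_cover (P := fun y p => p.1.2 == y) _) _.
  by move=> p _; exists p.1.2.
rewrite big_distrr; apply: leq_sum => y _ /=.
apply: (@card_fiber_le _ _ _ _ (fun p => (lin p.1.2 p.1.1, lin p.1.2 p.2))).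
  move=> [[x y'] z] /setIdP[/setIdP[]]; rewrite inE /= => p1 /andP[/eqP li /eqP lj] /eqP yy.
  rewrite {}yy {y'} in p1 li lj *; have /and3P[xy yz _] := p1.
  have mem u : y != u -> lin y u \in pencil (8 ^ level y u) y.
    move=> yu; apply/setIdP; split; last exact: line_l.
    by apply/setIdP; split; [exact: mem_lines | exact: level_le].
  by apply/setIdP; rewrite in_setX /= -li -lj !mem // 1?eq_sym //; split=> //; apply: right_perp.
(* A pencil bounds the sizes of [L] and [M] only from below; the upper bounds come from the levels
   of a member of the fibre. *)
move=> [L M] _ /=; set F := [set a in _ | _].
have [->|[p0]] := set_0Vmem F; first by rewrite cards0.
case: p0 => -[x0 y0] z0 /setIdP[/setIdP[/setIdP[_ /andP[/= /eqP li /eqP lj]] /eqP E]] /eqP[EL EM].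
rewrite -li -lj; apply: (@leq_trans (#|setX L M|)); last first.
  by rewrite cardsX leq_mul // ltnW // -?EL -?EM level_gt.
apply: (@card_le_rel _ _ _ _ (fun p b => p.1.1 = b.1 /\ p.2 = b.2)).
  move=> [[x y'] z] /setIdP[_ /eqP[<- <-]].
  by exists (x, z) => //; rewrite in_setX !line_r.
move=> [[x1 y1] z1] [[x2 y2] z2] /setIdP[/setIdP[_ /eqP /= ->] _].
by move=> /setIdP[/setIdP[_ /eqP /= ->] _] b [<- <-] [<- <-].
Qed.

Lemma level_angles_le (i j m : nat) : (j <= i)%N -> (i < m)%N ->
  (512 ^ m <= #|T|)%N -> (#|T| <= 512 ^ m.+1)%N ->
  (#|level_angles i j| <=
    64 * ((650 + 260 * 512) * #|T| ^ 2 * (8 ^ (i - j) + 4 ^ m * 2 ^ (m - i))))%N.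
Proof.
move=> ji im mn nm.
have lev k : (k <= m)%N -> (64 ^ k * \sum_y #|pencil (8 ^ k) y| <= 130 * #|T| ^ 2)%N.
  move=> km; rewrite sum_pencil; apply: rich_level.
  apply: leq_trans mn; apply: leq_trans (_ : 64 ^ m <= _)%N; first by rewrite leq_exp2l.
  by rewrite leq_exp2r //; case: m im {nm km}.
(* One factor of the square is bounded by [card_rich_pencil], the sum of the other by [lev]. *)
have Qj : (512 ^ j * \sum_y #|pencil (8 ^ j) y| ^ 2 <= 260 * #|T| ^ 3)%N.
  apply: (@leq_trans (64 ^ j * (\sum_y #|pencil (8 ^ j) y|) * (2 * #|T|)))%N; last first.
    have := lev j (leq_trans ji (ltnW im)); move: (\sum_y _)%N (64 ^ j)%N #|T| => a b n h; nia.
  have -> : (512 ^ j = 64 ^ j * 8 ^ j)%N by rewrite -expnMn.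
  rewrite -!mulnA leq_mul2l; apply/orP; right; rewrite big_distrr big_distrl /=.
  apply: leq_sum => y _; have : (8 ^ j * #|pencil (8 ^ j) y| <= 2 * #|T|)%N.
    exact: (card_rich_pencil xyz_inj).
  move: #|pencil (8 ^ j) y| => a; move: (8 ^ j)%N #|T| => b n; nia.
have p8 k : (8 ^ k = (2 ^ k) ^ 3)%N by rewrite -expnM mulnC expnM.
have p4 k : (4 ^ k = (2 ^ k) ^ 2)%N by rewrite -expnM mulnC expnM.
have p64 k : (64 ^ k = (2 ^ k) ^ 6)%N by rewrite -expnM mulnC expnM.
have p512 k : (512 ^ k = (2 ^ k) ^ 9)%N by rewrite -expnM mulnC expnM.
apply: leq_trans (level_angles_perp i j) _.
have -> : (8 ^ i.+1 * 8 ^ j.+1 = 64 * (8 ^ i * 8 ^ j))%N.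
  by rewrite !expnS; move: (8 ^ i)%N (8 ^ j)%N => a b; ring.
rewrite -mulnA leq_mul2l; apply/orP; right.
have := lev i (ltnW im); have := lev j (leq_trans ji (ltnW im)).
pose a := (i - j)%N; pose b := (m - i)%N.
have iE : i = (j + a)%N by rewrite /a subnKC.
have mE : m = (j + a + b)%N by rewrite -iE /b subnKC // ltnW.
rewrite -/a -/b; pose q := ((2 ^ j) ^ 2 * (2 ^ a) ^ 5 * (2 ^ b) ^ 3)%N.
have q0 : (0 < q)%N by rewrite /q !(expn_gt0, muln_gt0).
have hq : (q ^ 2 * \sum_y #|perp_pencil i j y| <=
   q ^ 2 * (\sum_y #|pencil (8 ^ j) y|) + 4 * q ^ 3 * (\sum_y #|pencil (8 ^ i) y|) +
   \sum_y #|pencil (8 ^ j) y| ^ 2)%N.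
  rewrite !big_distrr -!big_split; apply: leq_sum => y _ /=.
  exact: pencil_incidences.
move=> hj hi; rewrite p64 in hj; rewrite p64 {1}iE expnD in hi; rewrite p512 in Qj.
have hn : (#|T| <= 512 * (2 ^ j * 2 ^ a * 2 ^ b) ^ 9)%N.
  by move: nm; rewrite expnS p512 mE !expnD.
have := @level_arith (2 ^ j) (2 ^ a) (2 ^ b) _ _ _ _ _ _ _ _ hq hj hi Qj hn.
rewrite !expn_gt0 => /(_ isT isT isT).
have -> : (8 ^ i * 8 ^ j = (2 ^ j) ^ 6 * (2 ^ a) ^ 3)%N.
  by rewrite !p8 iE expnD; move: (2 ^ j)%N (2 ^ a)%N => u v; ring.
have -> : (4 ^ m * 2 ^ b = (2 ^ j) ^ 2 * (2 ^ a) ^ 2 * (2 ^ b) ^ 3)%N.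
  by rewrite p4 mE !expnD; move: (2 ^ j)%N (2 ^ a)%N (2 ^ b)%N => u v w; ring.
by rewrite p8.
Qed.

Definition right_angles_const : nat :=
  2 * (130 * 512 + 64 * (650 + 260 * 512) * 5).

(** Here [8 ^ m] is about the cube root of the number of points. By symmetry the leg to [x] may be
    taken at the higher level; from level [m] on, [rich_angles_le] applies, and below it the level
    bounds are summed. *)
Lemma card_angles (m : nat) : (512 ^ m <= #|T|)%N -> (#|T| <= 512 ^ m.+1)%N ->
  (#|angles| <= right_angles_const * (#|T| ^ 2 * 8 ^ m))%N.
Proof.
move=> mn nm.
pose lx (p : T * T * T) := level p.1.2 p.1.1.
pose lz (p : T * T * T) := level p.1.2 p.2.
pose A1 := [set p in angles | (lz p <= lx p)%N].
have A1le : (#|angles| <= 2 * #|A1|)%N.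
  rewrite -(cardsID A1) mul2n -addnn leq_add //.
    by rewrite subset_leq_card // subsetIr.
  apply: (@card_le_rel _ _ _ _ (fun p b => b = (p.2, p.1.2, p.1.1))).
    move=> [[x y] z] /setDP[p1 p2]; exists (z, y, x) => //.
    move: p1 p2; rewrite !inE /= => p1; rewrite p1 -ltnNge rightC p1 /=.
    exact: ltnW.
  by move=> [[x y] z] [[x' y'] z'] _ _ b /= -> [-> -> ->].
pose P := [set p in angles | (lz p <= lx p)%N && (lx p < m)%N].
have rich_part : (#|[set p in angles | (8 ^ m <= #|lin p.1.2 p.1.1|)%N]| <=
    130 * 512 * (#|T| ^ 2 * 8 ^ m))%N.
  have h64 : (64 ^ m <= #|T|)%N.
    by apply: leq_trans mn; case: m {nm P} => // m; rewrite leq_exp2r.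
  have := rich_level h64; have := rich_angles_le (8 ^ m).
  move: #|[set p in angles | _]| (\sum_(L in _) _)%N => a s h1 h2.
  have e64 : (0 < 64 ^ m)%N by rewrite expn_gt0.
  have e512 : (512 ^ m = 64 ^ m * 8 ^ m)%N by rewrite -expnMn.
  have hn := nm; rewrite expnS e512 in hn.
  (* Times [64 ^ m] the count is at most [130 n^3], and one factor [n] is at most
     [512 * 64 ^ m * 8 ^ m]. *)
  rewrite -(leq_pmul2l e64); apply: (@leq_trans (130 * #|T| ^ 2 * #|T|)%N).
    apply: leq_trans (leq_mul (leqnn _) h1) _.
    by rewrite mulnA leq_mul2r h2 orbT.
  apply: leq_trans (leq_mul (leqnn _) hn) _; rewrite leq_eqVlt; apply/orP; left.
  by apply/eqP; move: (64 ^ m)%N (8 ^ m)%N #|T| => b c n; ring.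
have poor_part : (#|P| <= 64 * (650 + 260 * 512) * 5 * (#|T| ^ 2 * 8 ^ m))%N.
  apply: (@leq_trans (\sum_(i < m) \sum_(j < i.+1) #|level_angles i j|)).
    apply: leq_trans (card_le_cover (P := fun (i : 'I_m) p => lx p == i) _) _.
      by move=> p /setIdP[_ /andP[_ lm]]; exists (Ordinal lm).
    apply: leq_sum => i _.
    apply: leq_trans (card_le_cover (P := fun (j : 'I_i.+1) p => lz p == j) _) _.
      by move=> p /setIdP[/setIdP[_ /andP[lm _]] /eqP <-]; exists (Ordinal (lm : (lz p < (lx p).+1)%N)).
    apply: leq_sum => j _; apply/subset_leq_card/subsetP => p.
    move=> /setIdP[/setIdP[/setIdP[pa _] pi] pj].
    by apply/setIdP; rewrite pa -/(lx p) -/(lz p) pi pj.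
  pose c := (64 * ((650 + 260 * 512) * #|T| ^ 2))%N.
  apply: (@leq_trans (\sum_(i < m) \sum_(j < i.+1) c * (8 ^ (i - j) + 4 ^ m * 2 ^ (m - i))))%N.
    apply: leq_sum => i _; apply: leq_sum => j _; rewrite /c -mulnA.
    by apply: level_angles_le mn nm; rewrite ?ltn_ord // -ltnS ltn_ord.
  apply: (@leq_trans (c * \sum_(i < m) (2 * 8 ^ i + 4 ^ m * (i.+1 * 2 ^ (m - i)))))%N.
    rewrite big_distrr; apply: leq_sum => i _ /=; rewrite -big_distrr /= leq_mul2l.
    apply/orP; right; rewrite big_split /= sum_nat_const card_ord.
    rewrite leq_add //; last by rewrite mulnCA.
    rewrite (reindex_inj rev_ord_inj) /=.
    rewrite (eq_bigr (fun j : 'I_i.+1 => 8 ^ j)%N); last first.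
      by move=> j _; rewrite subSS subKn // -ltnS.
    by have := geometric_sum i.+1; rewrite expnS; move: (\sum_(j < _) _)%N (8 ^ i)%N => a b; lia.
  rewrite big_split -!big_distrr /=.
  have := geometric_sum m; have := arith_geometric_sum m.
  have e8 : (8 ^ m = 4 ^ m * 2 ^ m)%N by rewrite -expnMn.
  rewrite {}e8; move: (\sum_(i < m) 8 ^ i)%N (\sum_(i < m) _)%N (4 ^ m)%N (2 ^ m)%N => a b u v h1 h2.
  (* The geometric sum contributes at most [2/7] and the arithmetic-geometric one at most 4. *)
  have h : (2 * a + u * b <= 5 * (u * v))%N by nia.
  apply: leq_trans (leq_mul (leqnn c) h) _; rewrite leq_eqVlt; apply/orP; left.
  by apply/eqP; rewrite /c; move: (650 + 260 * 512)%N => k; ring.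
apply: leq_trans A1le _; rewrite /right_angles_const -mulnA leq_mul2l mulnDl.
apply: leq_trans (leq_add rich_part poor_part).
apply: leq_trans (_ : #|[set p in angles | (8 ^ m <= #|lin p.1.2 p.1.1|)%N] :|: P| <= _)%N.
  apply/subset_leq_card/subsetP => p /setIdP[pa pl]; rewrite in_setU.
  apply/orP; have [h|h] := leqP m (lx p).
    left; apply/setIdP; split => //; apply: leq_trans (level_le _ _).
    by rewrite leq_exp2l.
  by right; apply/setIdP; rewrite pl h.
by rewrite cardsU leq_subr.
Qed.

End RightAngles.

(** * Right chains *)

Lemma sum_sqr3_neq0 (R : realFieldType) (x y z : R) :
  ~~ [&& x == 0, y == 0 & z == 0] -> x ^+ 2 + y ^+ 2 + z ^+ 2 != 0.
Proof.
by apply: contra; rewrite !paddr_eq0 ?addr_ge0 ?sqr_ge0 // !sqrf_eq0 -andbA.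
Qed.

Section ChainExtension.
Variables (R : realFieldType) (T : finType) (X Y Z : T -> R).

Hypothesis xyz_inj : forall u v, X u = X v -> Y u = Y v -> Z u = Z v -> u = v.

Local Notation rd := (rdot X Y Z).
Local Notation right_angle := (right_angle X Y Z).
Local Notation angles := (angles X Y Z).

Variables (a b : T).
Hypothesis ab : a != b.

Let dd : R := rd a b a.

Let dd_gt0 : 0 < dd. Proof. exact: rdot_self_gt0. Qed.

(* The planes orthogonal to [ab] and to [fd] are parallel. *)
Definition parallel_legs (d f : T) : bool :=
  [&& (Y a - Y b) * (Z f - Z d) == (Z a - Z b) * (Y f - Y d),
      (Z a - Z b) * (X f - X d) == (X a - X b) * (Z f - Z d) &
      (X a - X b) * (Y f - Y d) == (Y a - Y b) * (X f - X d)].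

Definition link (c d f : T) : bool :=
  [&& right_angle a b c, right_angle b c d & right_angle c d f].

Lemma parallel_legs_ex (d f : T) : parallel_legs d f -> exists k,
  [/\ X f - X d = k * (X a - X b), Y f - Y d = k * (Y a - Y b) &
      Z f - Z d = k * (Z a - Z b)].
Proof.
move=> /and3P[/eqP h0 /eqP h1 /eqP h2]; apply: cross_eq0_scale => //.
apply: contra ab; rewrite !subr_eq0 => /and3P[/eqP hx /eqP hy /eqP hz].
by apply/eqP/xyz_inj.
Qed.

(* A line meets a sphere in at most two points. *)
Lemma card_link_le2 (d f : T) : ~~ parallel_legs d f ->
  (#|[set c | link c d f]| <= 2)%N.
Proof.
move=> npar; rewrite leqNgt; apply/negP => /card_gt2P[u [v [w [[hu hv hw] [uv vw wu]]]]].
move: hu hv hw; rewrite !inE.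
move=> /and3P[/and3P[_ _ /eqP u1] /and3P[_ _ /eqP u2] /and3P[_ _ /eqP u3]].
move=> /and3P[/and3P[_ _ /eqP v1] /and3P[_ _ /eqP v2] /and3P[_ _ /eqP v3]].
move=> /and3P[/and3P[_ _ /eqP w1] /and3P[_ _ /eqP w2] /and3P[_ _ /eqP w3]].
rewrite /rdot in u1 u2 u3 v1 v2 v3 w1 w2 w3.
(* The cross product of the two normals, which directs the line common to the two planes. *)
pose n0 := (Y a - Y b) * (Z f - Z d) - (Z a - Z b) * (Y f - Y d).
pose n1 := (Z a - Z b) * (X f - X d) - (X a - X b) * (Z f - Z d).
pose n2 := (X a - X b) * (Y f - Y d) - (Y a - Y b) * (X f - X d).
have nz : ~~ [&& n0 == 0, n1 == 0 & n2 == 0] by rewrite !subr_eq0.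
have dir (x y z : R) :
    (X a - X b) * x + (Y a - Y b) * y + (Z a - Z b) * z = 0 ->
    (X f - X d) * x + (Y f - Y d) * y + (Z f - Z d) * z = 0 ->
    exists k, [/\ x = k * n0, y = k * n1 & z = k * n2].
  move=> h1 h2; apply: cross_eq0_scale => //; apply/eqP; rewrite -subr_eq0; apply/eqP.
  - transitivity ((X f - X d) * ((X a - X b) * x + (Y a - Y b) * y + (Z a - Z b) * z) -
      (X a - X b) * ((X f - X d) * x + (Y f - Y d) * y + (Z f - Z d) * z)).
      by rewrite /n1 /n2; ring.
    by rewrite h1 h2; ring.
  - transitivity ((Y f - Y d) * ((X a - X b) * x + (Y a - Y b) * y + (Z a - Z b) * z) -
      (Y a - Y b) * ((X f - X d) * x + (Y f - Y d) * y + (Z f - Z d) * z)).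
      by rewrite /n0 /n2; ring.
    by rewrite h1 h2; ring.
  - transitivity ((Z f - Z d) * ((X a - X b) * x + (Y a - Y b) * y + (Z a - Z b) * z) -
      (Z a - Z b) * ((X f - X d) * x + (Y f - Y d) * y + (Z f - Z d) * z)).
      by rewrite /n0 /n1; ring.
    by rewrite h1 h2; ring.
have [k [kx ky kz]] := dir (X v - X u) (Y v - Y u) (Z v - Z u) ltac:(lra) ltac:(lra).
have [l [lx ly lz]] := dir (X w - X u) (Y w - Y u) (Z w - Z u) ltac:(lra) ltac:(lra).
have k0 : k != 0.
  apply: contraNneq uv => k0; apply/eqP/xyz_inj; move: kx ky kz; rewrite k0 !mul0r => *; lra.
have l0 : l != 0.
  apply: contraNneq wu => l0; apply/eqP/xyz_inj; move: lx ly lz; rewrite l0 !mul0r => *; lra.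
have kl : k != l.
  by apply: contraNneq vw => E; apply/eqP/xyz_inj; move: lx ly lz; rewrite -E => *; lra.
have vx : X v = X u + k * n0 by rewrite -kx; ring.
have vy : Y v = Y u + k * n1 by rewrite -ky; ring.
have vz : Z v = Z u + k * n2 by rewrite -kz; ring.
have wx : X w = X u + l * n0 by rewrite -lx; ring.
have wy : Y w = Y u + l * n1 by rewrite -ly; ring.
have wz : Z w = Z u + l * n2 by rewrite -lz; ring.
pose nn := n0 ^+ 2 + n1 ^+ 2 + n2 ^+ 2.
have nn0 : nn != 0 by exact: sum_sqr3_neq0.
(* The point [u + t n] is on the sphere exactly when [t (t nn + m) = 0], which has a single nonzero
   root at most, against [k != l]. *)
pose m := - (n0 * (X b + X d - 2 * X u) + n1 * (Y b + Y d - 2 * Y u) + n2 * (Z b + Z d - 2 * Z u)).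
have kE : k * (k * nn + m) = 0.
  move: v2; rewrite vx vy vz => v2; rewrite -[RHS]subr0 -{1}v2 -u2 /nn /m; ring.
have lE : l * (l * nn + m) = 0.
  move: w2; rewrite wx wy wz => w2; rewrite -[RHS]subr0 -{1}w2 -u2 /nn /m; ring.
have kE' : k * nn + m = 0 by move/eqP: kE; rewrite mulf_eq0 (negbTE k0) => /eqP.
have lE' : l * nn + m = 0 by move/eqP: lE; rewrite mulf_eq0 (negbTE l0) => /eqP.
have /eqP : (k - l) * nn = 0 by lra.
by rewrite mulf_eq0 subr_eq0 (negbTE kl) (negbTE nn0).
Qed.

(** In the plane through [b] orthogonal to [ab], a right angle [b, c, d] says that [d] is on the
    line through [c] orthogonal to [bc]. Distinct [c] give distinct lines, so these are point-line
    incidences. *)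
Lemma card_planar_right_angles (q : nat) : (0 < q)%N ->
  (q ^ 2 * #|[set p : T * T | [&& right_angle a b p.1, rd a b p.2 == 0%R & right_angle b p.1 p.2]]|
   <= q ^ 2 * #|T| + 4 * q ^ 3 * #|T| + #|T| ^ 2)%N.
Proof.
move=> q0.
pose dx := X a - X b; pose dy := Y a - Y b; pose dz := Z a - Z b.
have ddE : dd = dx * dx + dy * dy + dz * dz by [].
pose A := [set d | rd a b d == 0].
pose B := [set c | (c != b) && (rd a b c == 0)].
have plane c : rd a b c = dx * (X c - X b) + dy * (Y c - Y b) + dz * (Z c - Z b) by [].
pose sq c := rd c b c.
have sqE c : sq c = (X c - X b) * (X c - X b) + (Y c - Y b) * (Y c - Y b) + (Z c - Z b) * (Z c - Z b) by [].
(* Homogeneous coordinates without a basis of the plane: the normal [a - b] serves as the third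
   axis. With the [r] vectors below, the product is [- dd * rd b c d]. *)
pose p0 d := dd * (X d - X b) + dx; pose p1 d := dd * (Y d - Y b) + dy.
pose p2 d := dd * (Z d - Z b) + dz.
pose r0 c := X c - X b - sq c * dx; pose r1 c := Y c - Y b - sq c * dy.
pose r2 c := Z c - Z b - sq c * dz.
have pdot d : rd a b d = 0 -> dx * p0 d + dy * p1 d + dz * p2 d = dd.
  move=> h; transitivity (dd * rd a b d + (dx * dx + dy * dy + dz * dz)).
    by rewrite plane /p0 /p1 /p2; ring.
  by rewrite h mulr0 add0r.
have rdt c : rd a b c = 0 -> dx * r0 c + dy * r1 c + dz * r2 c = - (sq c * dd).
  move=> h; transitivity (rd a b c - sq c * (dx * dx + dy * dy + dz * dz)).
    by rewrite plane /r0 /r1 /r2; ring.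
  by rewrite h sub0r -ddE.
have ddn : dd != 0 by rewrite gt_eqF.
have sqn c : c != b -> sq c != 0 by move=> cb; rewrite gt_eqF // rdot_self_gt0.
have pnz : {in A, forall d, ~~ [&& p0 d == 0, p1 d == 0 & p2 d == 0]}.
  move=> d; rewrite inE => /eqP /pdot E; apply/negP => /and3P[/eqP h0 /eqP h1 /eqP h2].
  by case/eqP: ddn; rewrite -E h0 h1 h2; ring.
have rnz : {in B, forall c, ~~ [&& r0 c == 0, r1 c == 0 & r2 c == 0]}.
  move=> c; rewrite inE => /andP[cb /eqP /rdt E]; apply/negP => /and3P[/eqP h0 /eqP h1 /eqP h2].
  have /eqP[] : sq c * dd != 0 by rewrite mulf_neq0 // sqn.
  by rewrite -[LHS]opprK -E h0 h1 h2; ring.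
have pnp : {in A &, forall d e k, p0 e = k * p0 d -> p1 e = k * p1 d -> p2 e = k * p2 d -> d = e}.
  move=> d e; rewrite !inE => /eqP /pdot Ed /eqP /pdot Ee k h0 h1 h2.
  have k1 : k = 1.
    apply: (mulIf ddn); rewrite mul1r -{1}Ed -Ee h0 h1 h2; ring.
  move: h0 h1 h2; rewrite k1 !mul1r => /addIr /(mulfI ddn) /addIr h0.
  move=> /addIr /(mulfI ddn) /addIr h1 /addIr /(mulfI ddn) /addIr h2.
  exact: xyz_inj.
have rnp : {in B &, forall c e k, r0 e = k * r0 c -> r1 e = k * r1 c -> r2 e = k * r2 c -> c = e}.
  move=> c e; rewrite !inE => /andP[cb /eqP /rdt Ec] /andP[eb /eqP /rdt Ee] k h0 h1 h2.
  have sk : sq e = k * sq c.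
    apply: (mulIf ddn); apply: oppr_inj; rewrite -Ee h0 h1 h2 -mulrA -mulrN -Ec; ring.
  have xk : X e - X b = k * (X c - X b).
    transitivity (r0 e + sq e * dx); first by rewrite /r0; ring.
    by rewrite h0 sk /r0; ring.
  have yk : Y e - Y b = k * (Y c - Y b).
    transitivity (r1 e + sq e * dy); first by rewrite /r1; ring.
    by rewrite h1 sk /r1; ring.
  have zk : Z e - Z b = k * (Z c - Z b).
    transitivity (r2 e + sq e * dz); first by rewrite /r2; ring.
    by rewrite h2 sk /r2; ring.
  (* Proportionality gives [sq e = k * sq c], while scaling [c - b] by [k] gives
     [sq e = k ^+ 2 * sq c]. *)
  have /eqP : k * (k - 1) * sq c = 0.
    transitivity (sq e - k * sq c); last by rewrite sk subrr.
    by rewrite [sq e]sqE xk yk zk sqE; ring.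
  rewrite !mulf_eq0 (negbTE (sqn _ cb)) orbF subr_eq0 => /orP[/eqP k0|/eqP k1].
    by move: (sqn _ eb); rewrite sk k0 mul0r eqxx.
  by apply: xyz_inj; [move: xk|move: yk|move: zk]; rewrite k1 mul1r => /addIr.
have := szemeredi_trotter_dual pnz rnz pnp rnp q0.
have cA : (#|A| <= #|T|)%N by apply: max_card.
have cB : (#|B| <= #|T|)%N by apply: max_card.
set S := [set p in setX A B | _] => hS.
have SL : (#|[set p : T * T | [&& right_angle a b p.1, rd a b p.2 == 0%R & right_angle b p.1 p.2]]| <= #|S|)%N.
  apply: (@card_le_rel _ _ _ _ (fun p s => s = (p.2, p.1))).
    move=> [c d]; rewrite inE /= => /and3P[/and3P[_ bc pc] pd /and3P[_ _ /eqP h]].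
    exists (d, c) => //; rewrite !inE /= pd pc eq_sym bc /=; apply/eqP.
    transitivity (- dd * rd b c d + rd a b c - dd * sq c * rd a b d).
      by rewrite /p0 /p1 /p2 /r0 /r1 /r2 sqE ddE /rdot -/dx -/dy -/dz; ring.
    by rewrite h (eqP pc) (eqP pd) !mulr0 subr0 addr0.
  by move=> [c d] [c' d'] _ _ s /= -> [-> ->].
apply: (@leq_trans (q ^ 2 * #|S|)%N); first by rewrite leq_mul2l SL orbT.
apply: leq_trans hS _; rewrite !leq_add ?leq_mul2l ?cA ?cB ?orbT //.
by rewrite leq_exp2r.
Qed.

Lemma plane_shift (d f : T) k : X f - X d = k * (X a - X b) ->
  Y f - Y d = k * (Y a - Y b) -> Z f - Z d = k * (Z a - Z b) ->
  rd a b f - rd a b d = k * dd.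
Proof.
move=> kx ky kz.
transitivity ((X a - X b) * (X f - X d) + (Y a - Y b) * (Y f - Y d) +
  (Z a - Z b) * (Z f - Z d)); first by rewrite /rdot; ring.
by rewrite kx ky kz /dd /rdot; ring.
Qed.

(** The right angle at [d] makes [c - d] orthogonal to [f - d], hence to [a - b]; so [d] is in the
    plane of [b] and [c]. *)
Lemma link_plane (c d f : T) : parallel_legs d f -> link c d f ->
  rd a b d = 0.
Proof.
move=> /parallel_legs_ex[k [kx ky kz]].
move=> /and3P[/and3P[_ _ /eqP h1] _ /and3P[_ df /eqP h2]].
have k0 : k != 0.
  apply: contraNneq df => k0; rewrite k0 !mul0r in kx ky kz.
  by apply/eqP/xyz_inj; apply/esym/eqP; rewrite -subr_eq0 ?kx ?ky ?kz.
apply: (mulfI k0); transitivity (k * rd a b c - rd c d f).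
  by rewrite /rdot kx ky kz; ring.
by rewrite h1 h2; ring.
Qed.

(** In the parallel case [d] is the projection of [f] on the plane through [b], so [c] and [f]
    suffice. Otherwise [d] and [f] leave two choices for [c]. *)
Lemma card_link_pairs : (#|[set p : T * (T * T) | link p.1 p.2.1 p.2.2]| <= 3 * #|T| ^ 2)%N.
Proof.
set L := [set p | _]; pose D := [set p in L | parallel_legs p.2.1 p.2.2].
rewrite -(cardsID D L).
have -> : (3 * #|T| ^ 2 = #|T| ^ 2 + 2 * #|T| ^ 2)%N by ring.
rewrite -mulnn -card_prod -cardsT leq_add //.
  apply: leq_trans (subset_leq_card (subsetIr _ _)) _.
  apply: (@card_le_rel _ _ _ _ (fun p s => s = (p.1, p.2.2))).
    by move=> [c [d f]] _; exists (c, f); rewrite ?inE.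
  move=> [c [d f]] [c' [d' f']] /setIdP[]; rewrite inE /= => h /[dup] /parallel_legs_ex[k [kx ky kz]].
  move=> /link_plane /(_ h) hd.
  move=> /setIdP[]; rewrite inE /= => h' /[dup] /parallel_legs_ex[k' [kx' ky' kz']].
  move=> /link_plane /(_ h') hd' s -> [E1 E2]; rewrite -{}E1 -{}E2 {c' f' h'} in kx' ky' kz' *.
  have kk : k = k'.
    apply: (mulIf (lt0r_neq0 dd_gt0)).
    by rewrite -(plane_shift kx ky kz) -(plane_shift kx' ky' kz') hd hd'.
  have -> // : d = d'.
  by apply: xyz_inj; [move: kx kx'|move: ky ky'|move: kz kz']; rewrite kk => <- /addrI/oppr_inj.
apply: (@card_fiber_le _ _ _ _ (fun p => p.2)).
  by move=> p _; rewrite inE.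
move=> [d f] _; have [par|npar] := boolP (parallel_legs d f).
  rewrite (_ : [set _ in _ | _] = set0) ?cards0 //; apply/setP => -[c p]; rewrite !inE /=.
  by apply/negP => /andP[/andP[/negP h l] /eqP E]; rewrite E /= in h l; rewrite l par in h.
apply: leq_trans (card_link_le2 npar).
apply: (@card_le_rel _ _ _ _ (fun p c => p.1 = c)).
  move=> [c p]; rewrite !inE => /= /andP[/andP[_ l] /eqP E]; exists c => //.
  by rewrite E in l; rewrite inE.
by move=> [c p] [c' p'] /setIdP[_ /eqP /= ->] /setIdP[_ /eqP /= ->] x -> ->.
Qed.

Lemma card_link_angles :
  (#|[set p : T * (T * T * T) | link p.1 p.2.1.1 p.2.1.2 && right_angle p.2.1.1 p.2.1.2 p.2.2]| <=
   2 * #|angles| +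
   #|[set p : T * T | [&& right_angle a b p.1, rd a b p.2 == 0%R & right_angle b p.1 p.2]]| * #|T|)%N.
Proof.
set L := [set p | _]; pose D := [set p in L | parallel_legs p.2.1.1 p.2.1.2].
set S := [set p : T * T | _].
rewrite -(cardsID D L) addnC leq_add //; last first.
  rewrite -cardsT -cardsX; apply: leq_trans (subset_leq_card (subsetIr _ _)) _.
  apply: (@card_le_rel _ _ _ _ (fun p s => s = ((p.1, p.2.1.1), p.2.2))).
    move=> [c [[d f] g]] /setIdP[]; rewrite inE /= => /andP[l _] par.
    exists ((c, d), g) => //; rewrite !inE /= (link_plane par l) eqxx.
    by case/and3P: l => -> ->.
  move=> [c [[d f] g]] [c' [[d' f'] g']] /setIdP[]; rewrite inE /= => /andP[l r].
  move=> /parallel_legs_ex[k [kx ky kz]] /setIdP[]; rewrite inE /= => /andP[l' r'].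
  move=> /parallel_legs_ex[k' [kx' ky' kz']] s -> [E1 E2 E3].
  rewrite -{}E1 -{}E2 -{}E3 {c' d' g' l'} in kx' ky' kz' r' *.
  (* On the line through [d] directed by [a - b], the apex [h] is the foot of the perpendicular from
     [g], so its parameter [m] depends on [g] only. *)
  have key h m : X h - X d = m * (X a - X b) -> Y h - Y d = m * (Y a - Y b) ->
      Z h - Z d = m * (Z a - Z b) -> right_angle d h g -> m * dd = rd a b g - rd a b d.
    move=> mx my mz /and3P[dh _ /eqP rh].
    have m0 : m != 0.
      apply: contraNneq dh => m0; rewrite m0 !mul0r in mx my mz.
      by apply/eqP/xyz_inj; apply/esym/eqP; rewrite -subr_eq0 ?mx ?my ?mz.
    apply: (mulfI m0); apply/eqP; rewrite -subr_eq0; apply/eqP.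
    transitivity (rd d h g); last by [].
    have hx : X h = X d + m * (X a - X b) by rewrite -mx; ring.
    have hy : Y h = Y d + m * (Y a - Y b) by rewrite -my; ring.
    have hz : Z h = Z d + m * (Z a - Z b) by rewrite -mz; ring.
    by rewrite /dd /rdot hx hy hz; ring.
  have kk : k = k'.
    apply: (mulIf (lt0r_neq0 dd_gt0)).
    by rewrite (key f k) // (key f' k').
  have -> // : f = f'.
  by apply: xyz_inj; [move: kx kx'|move: ky ky'|move: kz kz']; rewrite kk => <- /addIr.
apply: (@card_fiber_le _ _ _ _ (fun p => p.2)).
  by move=> [c [[d f] g]] /setDP[]; rewrite !inE /= => /andP[_ ->].
move=> [[d f] g] _; have [par|npar] := boolP (parallel_legs d f).
  rewrite (_ : [set _ in _ | _] = set0) ?cards0 //; apply/setP => -[c p]; rewrite !inE /=.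
  by apply/negP => /andP[/andP[/negP h l] /eqP E]; rewrite E /= in h l; rewrite l par in h.
apply: leq_trans (card_link_le2 npar).
apply: (@card_le_rel _ _ _ _ (fun p c => p.1 = c)).
  move=> [c p]; rewrite !inE => /= /andP[/andP[_ /andP[l _]] /eqP E]; exists c => //.
  by rewrite E in l; rewrite inE.
by move=> [c p] [c' p'] /setIdP[_ /eqP /= ->] /setIdP[_ /eqP /= ->] x -> ->.
Qed.

End ChainExtension.

(** * Counting chains by extension *)

Section Chains.
Variables (T : finType) (rt : T -> T -> T -> bool).

Definition chains (k : nat) : {set {ffun 'I_k.+2 -> T}} :=
  [set x : {ffun 'I_k.+2 -> T} |
     [forall j : 'I_k, rt (x (inord j)) (x (inord j.+1)) (x (inord j.+2))]].

Lemma chainsP (k : nat) (x : {ffun 'I_k.+2 -> T}) (j : nat) : x \in chains k ->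
  (j < k)%N -> rt (x (inord j)) (x (inord j.+1)) (x (inord j.+2)).
Proof. by rewrite inE => /forallP h jk; have := h (Ordinal jk). Qed.

Lemma ffun_inord_inj (k : nat) (x y : {ffun 'I_k.+1 -> T}) :
  (forall i, (i < k.+1)%N -> x (inord i) = y (inord i)) -> x = y.
Proof. by move=> h; apply/ffunP => i; rewrite -[i]inord_val h. Qed.

(** Restrict a chain to its first [k + 2] points. The map [f] encodes the added points, and the last
    two points kept confine the code to a set of size at most [M]. *)
Lemma card_chains_extension (k d M : nat) (B : finType) (S : T -> T -> {set B})
    (f : {ffun 'I_(k + d).+2 -> T} -> B) :
  {in chains (k + d) &, forall x y, f x = f y ->
     forall i, (k.+1 < i < (k + d).+2)%N -> x (inord i) = y (inord i)} ->
  {in chains (k + d), forall x,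
     f x \in S (x (inord k)) (x (inord k.+1)) /\ (#|S (x (inord k)) (x (inord k.+1))| <= M)%N} ->
  (#|chains (k + d)| <= M * #|chains k|)%N.
Proof.
move=> finj fS.
pose res (x : {ffun 'I_(k + d).+2 -> T}) : {ffun 'I_k.+2 -> T} := [ffun i : 'I_k.+2 => x (inord i)].
have resE x i : (i < k.+2)%N -> res x (inord i) = x (inord i).
  by move=> ik; rewrite ffunE inordK.
apply: (@card_fiber_le _ _ _ _ res).
  move=> x xc; rewrite inE; apply/forallP => j; have jk := ltn_ord j.
  rewrite !resE ?ltnS ?(ltnW jk) //; last exact: leqW (ltnW jk).
  by apply: chainsP => //; apply: leq_trans jk (leq_addr _ _).
(* The size of [S] is controlled only at an actual long chain, so an empty fibre is set apart. *)
move=> y _; have [->|[x0 /setIdP[x0c /eqP x0y]]] := set_0Vmem [set x in chains (k + d) | res x == y].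
  by rewrite cards0.
have [_] := fS _ x0c; apply: leq_trans.
apply: (@card_le_rel _ _ _ _ (fun x b => f x = b)).
  move=> x /setIdP[xc /eqP xy]; exists (f x) => //.
  have [h _] := fS _ xc; rewrite -!resE // in h *.
  by rewrite xy -x0y in h.
move=> x x' /setIdP[xc /eqP xy] /setIdP[xc' /eqP xy'] b E E'.
apply: ffun_inord_inj => i ik; have [h|h] := ltnP i k.+2.
  by rewrite -resE // xy -xy' resE.
by apply: finj => //; [rewrite E E' | rewrite h].
Qed.

End Chains.

Section RightChains.
Variables (R : realFieldType) (T : finType) (X Y Z : T -> R).

Hypothesis xyz_inj : forall u v, X u = X v -> Y u = Y v -> Z u = Z v -> u = v.

Local Notation rt := (right_angle X Y Z).

Lemma card_chains0 : #|chains rt 0| = (#|T| ^ 2)%N.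
Proof.
have -> : chains rt 0 = [set: {ffun 'I_2 -> T}].
  by apply/setP => x; rewrite !inE; apply/forallP => -[].
by rewrite cardsT card_ffun card_ord.
Qed.

Lemma card_chains1 : (#|chains rt 1| <= #|angles X Y Z|)%N.
Proof.
apply: (@card_le_rel _ _ _ _ (fun (x : {ffun 'I_3 -> T}) (p : T * T * T) =>
  p = (x (inord 0), x (inord 1), x (inord 2)))).
  by move=> x xc; exists (x (inord 0), x (inord 1), x (inord 2)); rewrite ?inE //; apply: (chainsP (j := 0) xc).
move=> x y _ _ p -> [E0 E1 E2]; apply: ffun_inord_inj => -[|[|[|//]]] _ //.
Qed.

Lemma card_chains2 : (#|chains rt 2| <= #|T| * #|chains rt 1|)%N.
Proof.
apply: (@card_chains_extension _ _ 1 1 #|T| T (fun _ _ => [set: T]) (fun x => x (inord 3))).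
  by move=> x y _ _ E [|[|[|[|i]]]].
by move=> x _; rewrite inE cardsT.
Qed.

(** Three points are added at once to a pair, so that the count of links saves a full factor [n]. *)
Lemma card_chains3 : (#|chains rt 3| <= 3 * #|T| ^ 2 * #|chains rt 0|)%N.
Proof.
apply: (@card_chains_extension _ _ 0 3 (3 * #|T| ^ 2) _
  (fun a b => [set p : T * (T * T) | link X Y Z a b p.1 p.2.1 p.2.2])
  (fun x => (x (inord 2), (x (inord 3), x (inord 4))))).
  by move=> x y _ _ [E2 E3 E4] [|[|[|[|[|i]]]]].
move=> x xc; have h0 := chainsP (j := 0) xc isT.
have h1 := chainsP (j := 1) xc isT; have h2 := chainsP (j := 2) xc isT.
rewrite inE /link h0 h1 h2; split => //.
by apply: card_link_pairs => //; case/and3P: h0.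
Qed.

(** The parameter is [q = 8 ^ m], and [517 = 1 + 4 + 512] collects the three terms. *)
Lemma card_planar_bound (m : nat) (a b : T) : a != b -> (#|T| <= 512 ^ m.+1)%N ->
  (#|[set p : T * T | [&& rt a b p.1, rdot X Y Z a b p.2 == 0%R & rt b p.1 p.2]]| <=
   517 * (#|T| * 8 ^ m))%N.
Proof.
move=> ab; have u0 : (0 < 8 ^ m)%N by rewrite expn_gt0.
have -> : (512 ^ m.+1 = 512 * (8 ^ m) ^ 3)%N by rewrite expnS -expnM [(m * 3)%N]mulnC expnM.
have := card_planar_right_angles xyz_inj ab u0.
move: #|[set p | _]|; move: (8 ^ m)%N u0 #|T| => u u0 n I h hn.
have u20 : (0 < u ^ 2)%N by rewrite expn_gt0 u0.
rewrite -(leq_pmul2l u20); apply: leq_trans h _.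
have h1 : (u ^ 2 * n <= u ^ 2 * (n * u))%N by rewrite leq_mul2l leq_pmulr ?orbT.
have h2 : (n ^ 2 <= n * (512 * u ^ 3))%N by rewrite -mulnn leq_mul2l hn orbT.
have -> : (u ^ 2 * (517 * (n * u)) = u ^ 2 * (n * u) + 4 * u ^ 3 * n + n * (512 * u ^ 3))%N by ring.
by rewrite !leq_add.
Qed.

Lemma card_chainsD4 (k m : nat) : (512 ^ m <= #|T|)%N -> (#|T| <= 512 ^ m.+1)%N ->
  (#|chains rt (k + 4)| <=
   (2 * right_angles_const + 517) * (#|T| ^ 2 * 8 ^ m) * #|chains rt k|)%N.
Proof.
move=> mn nm.
apply: (@card_chains_extension _ _ k 4 _ _
  (fun a b => [set p : T * (T * T * T) | link X Y Z a b p.1 p.2.1.1 p.2.1.2 && rt p.2.1.1 p.2.1.2 p.2.2])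
  (fun x => (x (inord k.+2), ((x (inord k.+3), x (inord k.+4)), x (inord k.+4.+1))))).
  move=> x y _ _ [E2 E3 E4 E5] i /andP[h1 h2].
  have : [|| i == k.+2, i == k.+3, i == k.+4 | i == k.+4.+1] by lia.
  by move=> /or4P[] /eqP ->.
move=> x xc; have lk j : (j < 4)%N -> (j + k < k + 4)%N by rewrite addnC ltn_add2l.
have h0 := chainsP (j := k) xc (lk 0%N isT).
have h1 := chainsP (j := k.+1) xc (lk 1%N isT).
have h2 := chainsP (j := k.+2) xc (lk 2%N isT).
have h3 := chainsP (j := k.+3) xc (lk 3%N isT).
rewrite inE /link h0 h1 h2 h3; split => //.
have ab : x (inord k) != x (inord k.+1) by case/and3P: h0.
apply: leq_trans (card_link_angles xyz_inj ab) _.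
have := card_angles xyz_inj mn nm; have := card_planar_bound ab nm.
move: #|[set p : T * T | _]| #|angles X Y Z| #|T| (8 ^ m)%N right_angles_const => I A n u C hI hA.
have -> : ((2 * C + 517) * (n ^ 2 * u) = 2 * (C * (n ^ 2 * u)) + 517 * (n * u) * n)%N by ring.
by rewrite leq_add // ?leq_mul2l // ?leq_mul2r ?hI ?hA ?orbT.
Qed.

End RightChains.

(* Three times the exponent of the chain bounds. *)
Definition chain_exp (k : nat) : nat :=
  (7 * (k %/ 4) + nth 0 [:: 6; 7; 10; 12] (k %% 4))%N.

Lemma chain_expD4 (k : nat) : chain_exp (k + 4) = (chain_exp k + 7)%N.
Proof. by rewrite /chain_exp modnDr divnDr // divnn mulnDr addnAC. Qed.

(** A form of [chain_exp k <= 19 + 7 (k - 7) / 4] without division, checked on residues modulo 4; it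
    is sharp for residue 3. *)
Lemma chain_exp_le (k : nat) : (4 * chain_exp k <= 7 * k + 27)%N.
Proof.
rewrite {2}(divn_eq k 4) /chain_exp; have := ltn_pmod k (isT : (0 < 4)%N).
move: (k %/ 4)%N (k %% 4)%N => q [|[|[|[|r]]]] //= _; lia.
Qed.

(** Induction in steps of four points. Bounds are in powers of [8 ^ m], which replaces the cube root
    of [n]; as [n <= 512 * (8 ^ m) ^ 3], this costs only constants. *)
Lemma chains_bound (R : realFieldType) (k : nat) : exists C : nat,
  forall (T : finType) (X Y Z : T -> R),
  (forall u v, X u = X v -> Y u = Y v -> Z u = Z v -> u = v) ->
  forall m, (512 ^ m <= #|T|)%N -> (#|T| <= 512 ^ m.+1)%N ->
  (#|chains (right_angle X Y Z) k| <= C * (8 ^ m) ^ chain_exp k)%N.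
Proof.
have cube m : (512 ^ m.+1 = 512 * (8 ^ m) ^ 3)%N.
  by rewrite expnS -expnM [(m * 3)%N]mulnC expnM.
have [q] := ubnP (k %/ 4); elim: q k => // q IH k kq.
have [k4|k4] := ltnP k 4; last first.
  have kE : k = (k - 4 + 4)%N by rewrite subnK.
  have [|C hC] := IH (k - 4)%N; first by move: kq; rewrite {1}kE divnDr // divnn; lia.
  exists ((2 * right_angles_const + 517) * 512 ^ 2 * C)%N => T X Y Z inj m mn nm.
  rewrite kE chain_expD4; apply: leq_trans (card_chainsD4 inj (k - 4) mn nm) _.
  have := hC T X Y Z inj m mn nm; move: nm; rewrite cube expnD.
  move: #|chains (right_angle X Y Z) (k - 4)| (chain_exp (k - 4)) => c e.
  move: (2 * right_angles_const + 517)%N => K.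
  move: #|T| (8 ^ m)%N (512)%N => n u p nm hc.
  apply: (@leq_trans (K * ((p * u ^ 3) ^ 2 * u) * (C * u ^ e))%N).
    by rewrite leq_mul // leq_mul2l leq_mul ?orbT // leq_exp2r.
  by rewrite leq_eqVlt; apply/orP; left; apply/eqP; move: (u ^ e)%N => w; ring.
have [K ang] : exists K : nat, forall (T : finType) (X Y Z : T -> R),
    (forall u v, X u = X v -> Y u = Y v -> Z u = Z v -> u = v) ->
    forall m, (512 ^ m <= #|T|)%N -> (#|T| <= 512 ^ m.+1)%N ->
    (#|chains (right_angle X Y Z) 1| <= K * (8 ^ m) ^ 7)%N.
  exists (right_angles_const * 512 ^ 2)%N => T X Y Z inj m mn nm.
  apply: leq_trans (card_chains1 X Y Z) _.
  apply: leq_trans (card_angles inj mn nm) _; rewrite cube in nm; move: nm.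
  move: #|T| (8 ^ m)%N right_angles_const (512)%N => n u K p nm.
  apply: (@leq_trans (K * ((p * u ^ 3) ^ 2 * u))%N).
    by rewrite leq_mul2l leq_mul ?orbT // leq_exp2r.
  by rewrite leq_eqVlt; apply/orP; left; apply/eqP; ring.
case: k k4 {kq} => [|[|[|[|//]]]] _.
- exists (512 ^ 2)%N => T X Y Z inj m _; rewrite cube card_chains0 => nm.
  have -> : chain_exp 0 = (3 * 2)%N by [].
  by rewrite [in leqRHS]expnM -expnMn leq_exp2r.
- by exists K.
- exists (512 * K)%N => T X Y Z inj m mn nm.
  apply: leq_trans (card_chains2 X Y Z) _.
  have := ang T X Y Z inj m mn nm; rewrite cube in nm; move: nm.
  have -> : chain_exp 2 = (3 + 7)%N by [].
  rewrite expnD.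
  move: #|chains (right_angle X Y Z) 1| => c.
  move: #|T| (8 ^ m)%N (512)%N => n u p h1 h2.
  apply: leq_trans (leq_mul h1 h2) _.
  by rewrite leq_eqVlt; apply/orP; left; apply/eqP; ring.
- exists (3 * 512 ^ 4)%N => T X Y Z inj m mn nm.
  apply: leq_trans (card_chains3 inj) _; rewrite card_chains0.
  have -> : chain_exp 3 = (3 * 4)%N by [].
  have h : (#|T| ^ 4 <= (512 * (8 ^ m) ^ 3) ^ 4)%N by rewrite leq_exp2r // -cube.
  by rewrite expnMn -expnM in h; rewrite -mulnA -expnD -mulnA leq_mul2l h orbT.
Qed.

(* Imported only now: the sets of mathcomp-classical shadow those of finset. *)
Require Import Defs.
From mathcomp Require Import finmap.
From mathcomp Require Import all_classical reals exp trigo.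

(** * From row vectors to coordinates, and real exponents *)

Lemma dot3E (R : realType) (u v : 'rV[R]_3) :
  dot u v = u ord0 0 * v ord0 0 + u ord0 1 * v ord0 1 + u ord0 2%:R * v ord0 2%:R.
Proof.
rewrite /dot !big_ord_recl big_ord0 addr0 addrA.
by do ![congr (_ + _)|congr (_ * _)]; congr (_ _ _); apply: val_inj.
Qed.

Lemma row3_eq (R : realType) (u v : 'rV[R]_3) :
  u ord0 0 = v ord0 0 -> u ord0 1 = v ord0 1 -> u ord0 2%:R = v ord0 2%:R -> u = v.
Proof.
move=> h0 h1 h2; apply/rowP => -[[|[|[|//]]] i3].
- by move: h0; congr (_ = _); congr (_ _ _); apply: val_inj.
- by move: h1; congr (_ = _); congr (_ _ _); apply: val_inj.
- by move: h2; congr (_ = _); congr (_ _ _); apply: val_inj.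
Qed.

(** Taking cosines requires the argument of [acos] to be in [[-1, 1]]: this is the Cauchy-Schwarz
    inequality, proved by Lagrange's identity. Distinctness of the points makes the denominator
    positive. *)
Lemma has_angle_pihalf (R : realType) (x y z : 'rV[R]_3) :
  has_angle x y z (pi / 2) -> [&& x != y, y != z & dot (x - y) (z - y) == 0].
Proof.
move=> /and3P[xy yz /eqP]; rewrite xy yz /= /angle.
have pos (u : 'rV[R]_3) : u != 0 -> 0 < dot u u.
  move=> u0; rewrite dot3E -!expr2 lt_neqAle !addr_ge0 ?sqr_ge0 // andbT eq_sym.
  apply: sum_sqr3_neq0; apply: contra u0 => /and3P[/eqP h0 /eqP h1 /eqP h2].
  by apply/eqP/row3_eq; rewrite mxE.
have xy0 : x - y != 0 by rewrite subr_eq0.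
have zy0 : z - y != 0 by rewrite subr_eq0 eq_sym.
move: (x - y) (z - y) xy0 zy0 => u v /pos u0 /pos v0.
have N0 : 0 < enorm u * enorm v by rewrite mulr_gt0 ?sqrtr_gt0.
have CS : dot u v ^+ 2 <= (enorm u * enorm v) ^+ 2.
  rewrite /enorm exprMn !sqr_sqrtr ?(ltW u0) ?(ltW v0) // -subr_ge0 !dot3E.
  move: (u ord0 0) (u ord0 1) (u ord0 2%:R) (v ord0 0) (v ord0 1) (v ord0 2%:R) => a b c d e f.
  have -> : (a * a + b * b + c * c) * (d * d + e * e + f * f) - (a * d + b * e + c * f) ^+ 2 =
    (a * e - b * d) ^+ 2 + (a * f - c * d) ^+ 2 + (b * f - c * e) ^+ 2 by ring.
  by rewrite !addr_ge0 ?sqr_ge0.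
move: (enorm u * enorm v) N0 CS => N N0 CS h.
have le1 : -1 <= dot u v / N <= 1.
  rewrite ler_pdivlMr // ler_pdivrMr // mulN1r mul1r -ler_norml.
  by rewrite -(ler_sqr (normr_nneg _)) ?real_normK ?num_real // nnegrE ltW.
have := acosK le1; rewrite h cos_pihalf => /esym/eqP.
by rewrite mulf_eq0 invr_eq0 (gt_eqF N0) orbF.
Qed.

Lemma right_Lambda_chains (R : realType) (k : nat) (E : {fset 'rV[R]_3}) :
  (#|right_Lambda k E| <= #|chains (right_angle (fun u : E => val u ord0 0%R)
     (fun u : E => val u ord0 1%R) (fun u : E => val u ord0 2%:R)) k|)%N.
Proof.
apply/subset_leq_card/fintype.subsetP => x; rewrite !inE => /forallP h; apply/forallP => j.
have := has_angle_pihalf (h j); rewrite dot3E !mxE => /and3P[h1 h2 h3].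
by apply/and3P; split.
Qed.

(** With [m] the logarithm of [n] to base 512 rounded down, [(8 ^ m) ^ 3 <= n], so powers of [8 ^ m]
    are bounded by powers of [n] with a third of the exponent. *)
Lemma right_chains_lesssim_chain_exp (R : realType) (k : nat) (e : R) :
  (chain_exp k)%:R / 3 <= e -> right_chains_lesssim k e.
Proof.
move=> he; have [C hC] := chains_bound R k.
(* The threshold 0 makes [E] nonempty, as the logarithm and [1 <= n] require. *)
exists C%:R, 0%N => E E0; set n := #|` E| in E0 *.
pose m := trunc_log 512 n.
have nE : #|{: E}| = n by rewrite -cardfE.
have mn : (512 ^ m <= n)%N by rewrite trunc_logP.
have nm : (n <= 512 ^ m.+1)%N by rewrite ltnW // trunc_log_ltn.
have := hC E (fun u => val u ord0 0) (fun u => val u ord0 1) (fun u => val u ord0 2%:R).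
move=> /(_ _ m); rewrite nE => /(_ _ mn nm) hE.
have inj (u v : E) : val u ord0 0 = val v ord0 0 -> val u ord0 1 = val v ord0 1 ->
    val u ord0 2%:R = val v ord0 2%:R -> u = v.
  by move=> h0 h1 h2; apply/val_inj/row3_eq.
have := leq_trans (right_Lambda_chains k E) (hE inj).
rewrite -(ler_nat R) natrM natrX => h; apply: le_trans h _.
rewrite ler_wpM2l //; set u : R := (8 ^ m)%:R.
have u0 : 0 <= u by rewrite /u.
have n1 : 1 <= n%:R :> R by rewrite ler1n.
have u3 : u ^+ 3 <= n%:R.
  by rewrite -natrX ler_nat -expnM mulnC expnM.
apply: le_trans (ler_powR n1 he).
have -> : u ^+ chain_exp k = (u ^+ 3) `^ ((chain_exp k)%:R / 3).
  by rewrite -!powR_mulrn // -powRrM mulrCA divff ?pnatr_eq0 ?mulr1.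
by apply: ge0_ler_powR; rewrite ?nnegrE ?divr_ge0 ?exprn_ge0.
Qed.

Theorem theorem2p4 (R : realType) :
  [/\ right_chains_lesssim 1 (7 / 3 : R),
      right_chains_lesssim 2 (10 / 3 : R),
      right_chains_lesssim 3 (4 : R),
      right_chains_lesssim 4 (13 / 3 : R) &
      right_chains_lesssim 5 (5 : R)] /\
  (forall k : nat, (6 <= k)%N ->
     right_chains_lesssim k
       (1 / 3 * (19 + Num.floor (7 * (k%:R - 7) / 4 : R))%:~R : R)).
Proof.
split.
  split; apply: right_chains_lesssim_chain_exp.
  - by have -> : chain_exp 1 = 7 by []; lra.
  - have -> : chain_exp 2 = 10 by [].
    lra.
  - have -> : chain_exp 3 = 12 by [].
    lra.
  - have -> : chain_exp 4 = 13 by [].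
    lra.
  (* The exponent obtained here is [14/3], below the claimed 5. *)
  - have -> : chain_exp 5 = 14 by [].
    lra.
move=> k _; apply: right_chains_lesssim_chain_exp.
have := chain_exp_le k; rewrite -(ler_nat R) natrD !natrM => h.
(* The left side is an integer, so its bound by the real quotient passes to the floor. *)
have fl : (chain_exp k)%:Z - 19 <= Num.floor (7 * (k%:R - 7) / 4 : R).
  rewrite floor_ge_int rmorphB /= -pmulrn; lra.
have : (chain_exp k)%:Z <= 19 + Num.floor (7 * (k%:R - 7) / 4 : R) by lra.
rewrite -(ler_int R) -pmulrn; lra.
Qed.
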